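(* Let $n\ge 1$ be an integer and let $\mathcal{P}_n\subset\mathbb{R}^n$ be the convex hull of all parking functions of length $n$. For an integer $S$ let $\mathcal{P}_{n,S}=\{x\in\mathcal{P}_n : x_1+\dots+x_n=S\}$, and let $N(P)$ denote the number of integer points (points of $\mathbb{Z}^n$) in a polytope $P\subset \mathbb{R}^n$. Then $$N(\mathcal{P}_n)=\sum_{S=n}^{n(n+1)/2}N(\mathcal{P}_{n,S}),$$ and for each integer $S$ with $n\le S\le \frac{n(n+1)}{2}$, $$N(\mathcal{P}_{n,S})=\frac{1}{(n-1)!}\sum_{(S_1,\dots,S_{n-1})}\left\{Y_{S_1}\cdots Y_{S_{n-1}}\right\},$$ where the summation is over ordered collections of subsets $S_1,\dots,S_{n-1}\subset[n]=\{1,\dots,n\}$ such that for any $k\ge1$ and any distinct indices $i_1,\dots,i_k$ one has $|S_{i_1}\cup\dots\cup S_{i_k}|\ge k+1$. Here the numbers $Y_I$ (depending on $n$ and $S$) and the bracket $\{\cdot\}$ are as defined in the context.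
   Context: A sequence $\alpha=(a_1,\dots,a_n)$ with $a_i\in\{1,\dots,n\}$ is a parking function of length $n$ if its weakly increasing rearrangement $b_1\le b_2\le\dots\le b_n$ satisfies $b_i\le i$ for all $i\in\{1,\dots,n\}$. Definition of $Y_I$. Fix $n$ and $S$ with $n\le S\le n(n+1)/2$. Define a vector $(x_1,\dots,x_n)$ as follows. If $S=n$, put $(x_1,\dots,x_n)=(1,\dots,1)$. If $S>n$, there is a unique pair of integers $(r,k)$ with $1\le k\le n-1$, $2\le r\le k+1$ and $k+r+\sum_{i=k+2}^{n} i=S$; put $$(x_1,\dots,x_n)=(\underbrace{1,\dots,1}_{k\text{ ones}},r,k+2,k+3,\dots,n).$$ For $1\le j\le n$ set $$y_j=\sum_{i=0}^{j-1}(-1)^i\binom{j-1}{i}x_{j-i},$$ i.e. $y_1=x_1$, $y_2=x_2-x_1$, $y_3=x_3-2x_2+x_1$, and so on. For each nonempty $I\subset[n]$ set $Y_I=y_{|I|}$. Definition of the bracket. A product $Y_{S_1}\cdots Y_{S_{n-1}}$ is regarded as a formal monomial $\prod_I Y_I^{a_I}$ in distinct variables indexed by nonempty subsets $I\subset[n]$, where $a_I$ is the number of indices $i$ with $S_i=I$. Then $$\left\{\prod_I Y_I^{a_I}\right\}:=(Y_{[n]}+1)^{\{a_{[n]}\}}\prod_{I\ne[n]}Y_I^{\{a_I\}},\qquad\text{where } Y^{\{a\}}=Y(Y+1)\cdots(Y+a-1)$$ (with $Y^{\{0\}}=1$), after which $Y_I$ is evaluated to the number $y_{|I|}$. *)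

(* Defs.v *)
From HB Require Import structures.
From mathcomp Require Import all_boot all_order all_algebra finmap.
From mathcomp Require Import boolp classical_sets cardinality reals convex.

Set Implicit Arguments.
Unset Strict Implicit.
Unset Printing Implicit Defensive.

Import Order.TTheory GRing.Theory Num.Theory.
Local Open Scope classical_set_scope.
Local Open Scope ring_scope.

(* The i-th entry (0-based) of the sorted rearrangement is b_(i+1). *)
Definition parking_function (n : nat) (a : n.-tuple nat) : Prop :=
  (forall i : 'I_n, (1 <= tnth a i <= n)%N) /\
  (forall i : 'I_n, (nth 0 (sort leq a) i <= i.+1)%N).

Definition parking_points (R : realType) (n : nat) : set 'rV[R]_n :=
  [set (\row_i (tnth a i)%:R : 'rV[R]_n) | a in @parking_function n].
Arguments parking_points : clear implicits.

Definition convex_hull (R : realType) (n : nat) (A : set 'rV[R]_n) :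
    set 'rV[R]_n :=
  smallest (fun B : set (convex_lmodType 'rV[R]_n) => convex_set B) A.

Definition parking_polytope (R : realType) (n : nat) : set 'rV[R]_n :=
  convex_hull (parking_points R n).
Arguments parking_polytope : clear implicits.

Definition parking_slice (R : realType) (n : nat) (S : int) : set 'rV[R]_n :=
  [set x | parking_polytope R n x /\ \sum_(i < n) x 0 i = S%:~R].
Arguments parking_slice : clear implicits.

(* [fset_set] is empty on infinite sets, so this is meaningful only when A
   contains finitely many integer points, as every bounded set does. *)
Definition nb_integer_points (R : realType) (n : nat) (A : set 'rV[R]_n) : nat :=
  #|` fset_set [set z : 'rV[int]_n | A (map_mx intr z)] |.

(* The conditions that characterize the pair (r, k) when n < S. *)
Definition rk_spec (n S r k : nat) : bool :=
  [&& (1 <= k <= n.-1)%N, (2 <= r <= k.+1)%N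
    & (k + r + \sum_(k.+2 <= i < n.+1) i == S)%N].

(* x_i, for 1 <= i <= n.  When n < S <= n(n+1)/2, exactly one pair satisfies
   [rk_spec]; the bounds r <= k + 1 <= n make 'I_n.+1 large enough. *)
Definition xcoord (n S i : nat) : nat :=
  if S == n then 1%N
  else if [pick p : 'I_n.+1 * 'I_n.+1 | rk_spec n S p.1 p.2] is Some (r, k)
       then if (i <= k)%N then 1%N else if i == k.+1 then r : nat else i
       else 1%N.

Definition ycoord (n S j : nat) : int :=
  \sum_(0 <= i < j) (-1) ^+ i * ('C(j.-1, i))%:Z * (xcoord n S (j - i))%:Z.

Definition Ysub (n S : nat) (I : {set 'I_n}) : int := ycoord n S #|I|.

Definition rising (y : int) (a : nat) : int := \prod_(0 <= i < a) (y + i%:Z).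

(* Formal monomials in the variables Y_I are represented by their exponent
   vectors, so that distinct I give distinct variables even if the values
   y_|I| coincide. *)
Definition monomial_of (n : nat) (T : {ffun 'I_n.-1 -> {set 'I_n}})
    (I : {set 'I_n}) : nat :=
  #|[set i | T i == I]%SET|.

Definition bracket (n S : nat) (a : {set 'I_n} -> nat) : int :=
  rising (Ysub S [set: 'I_n]%SET + 1) (a [set: 'I_n]%SET) *
  \prod_(I : {set 'I_n} | (I != finset.set0) && (I != [set: 'I_n]%SET))
     rising (Ysub S I) (a I).

(* A nonempty K : {set 'I_n.-1} is a choice of distinct indices i_1, ..., i_k. *)
Definition dragon_marriage (n : nat) (T : {ffun 'I_n.-1 -> {set 'I_n}}) : bool :=
  [forall K : {set 'I_n.-1},
     (K != finset.set0) ==> (#|K|.+1 <= #|(\bigcup_(i in K) T i)%SET|)%N].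

(* Main.v *)
(** An integer vector z of sum S lies in the parking polytope iff z_i >= 1 and
    the sum of any c coordinates is at most n + (n-1) + ... + (n-c+1): while two
    coordinates share a value >= 2, z is the midpoint of two integer vectors
    satisfying the same inequalities with a larger sum of squares, and otherwise
    z is itself a parking function.  Hence the slice of sum S consists of the
    integer points of the generalized permutohedron z(A) >= sum_(I \subset A)
      y_I,
    where y_I = Y_I and A |-> sum_(I \subset A) y_I is supermodular.

    Write N(y) for the number of these points, P(y) for the right-hand side of
    the formula, now as a polynomial in arbitrary integers y_I, and E_I F for
      the
    function y |-> F(y + e_I).  With U the union of I and J, both N and P are
    killed by (E_I - E_U)(E_J - E_U), are invariant under E_{i}, and satisfy
    E_U F = E_(U - i) F + F at those y whose coordinates y_J with i in J are all
    zero, for i in U <> {i}.  For N this is a comparison of sets of integer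
    points; for P it follows from the exchange properties of draconian families,
    since adding e_I to y amounts to prepending I to the family.

    These relations force N = P: the first one straightens a family of subsets
    into chains, chains are reduced by removing from a maximal member a vertex
    that lies in no smaller member, and negative y_I are reached backwards,
    because the relations also make E_I - 1 nilpotent. *)
Require Import Defs.
From HB Require Import structures.
From mathcomp Require Import all_boot all_order all_algebra finmap.
From mathcomp Require Import zify ring lra.

Set Implicit Arguments.
Unset Strict Implicit.
Unset Printing Implicit Defensive.

Import Order.TTheory GRing.Theory Num.Theory.
Local Open Scope ring_scope.

(** * Sums over words *)

(** Recursion on the first letter, instead of a sum over tuples, makes prepending a letter a
    computation step. *)
Fixpoint word_sum (X : finType) (N : nat) (G : seq X -> rat) : rat :=
  if N is N'.+1 then \sum_x word_sum N' (fun s => G (x :: s)) else G [::].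

Section WordSum.
Variable X : finType.
Implicit Types (G H : seq X -> rat) (N : nat) (x : X).

Lemma eq_word_sum N G H :
  (forall s, size s = N -> G s = H s) -> word_sum N G = word_sum N H.
Proof.
elim: N G H => [|N IH] G H eqGH /=; first exact: eqGH.
by apply: eq_bigr => x _; apply: IH => s sN; apply: eqGH; rewrite /= sN.
Qed.

Lemma word_sum0 N G : (forall s, size s = N -> G s = 0) -> word_sum N G = 0.
Proof.
elim: N G => [|N IH] G G0 /=; first exact: G0.
by apply: big1 => x _; apply: IH => s sN; apply: G0; rewrite /= sN.
Qed.

Lemma word_sumD N G H :
  word_sum N (fun s => G s + H s) = word_sum N G + word_sum N H.
Proof.
elim: N G H => [|N IH] G H //=.
by rewrite -big_split /=; apply: eq_bigr => x _; rewrite IH.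
Qed.

Lemma word_sumB N G H :
  word_sum N (fun s => G s - H s) = word_sum N G - word_sum N H.
Proof.
elim: N G H => [|N IH] G H //=.
by rewrite -sumrB; apply: eq_bigr => x _; rewrite IH.
Qed.

Lemma word_sumS N G :
  word_sum N.+1 G = \sum_x word_sum N (fun s => G (x :: s)).
Proof. by []. Qed.

(** Each of the [N.+1] positions at which [x] may stand contributes equally, since [G] ignores the
    order of the letters. *)
Lemma word_sum_count N G x :
    (forall s t, perm_eq s t -> G s = G t) ->
  word_sum N.+1 (fun s => (count_mem x s)%:R * G s)
  = N.+1%:R * word_sum N (fun s => G (x :: s)).
Proof.
elim: N G => [|N IH] G permG.
  rewrite /= (bigD1 x) //= big1 ?eqxx ?addr0 // => y /negPf yx.
  by rewrite yx mul0r.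
(* The first letter is separated from the tail: the first sum collects the words starting with [x],
   the second counts [x] in the tail. *)
transitivity (word_sum N.+1 (fun s => G (x :: s))
    + \sum_y word_sum N.+1 (fun s => (count_mem x s)%:R * G (y :: s))).
  have -> : word_sum N.+1 (fun s => G (x :: s))
      = \sum_y word_sum N.+1 (fun s => (y == x)%:R * G (y :: s)).
    rewrite (bigD1 x) // big1 => [|y /negPf yx].
      by rewrite [RHS]addr0; apply: eq_word_sum => s _; rewrite eqxx mul1r.
    by apply: (@word_sum0 N.+1) => s _; rewrite yx mul0r.
  rewrite word_sumS -big_split; apply: eq_bigr => y _.
  rewrite -[RHS](@word_sumD N.+1); apply: (@eq_word_sum N.+1) => s _.
  by rewrite -mulrDl -natrD.
rewrite -[N.+2]add1n natrD mulrDl mul1r (word_sumS _ (fun s => G (x :: s))).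
rewrite mulr_sumr; congr (_ + _); apply: eq_bigr => y _.
rewrite IH; last by move=> s t st; apply: permG; rewrite perm_cons.
congr (_ * _); apply: eq_word_sum => s _; apply: permG.
by rewrite (perm_catCA [:: y] [:: x] s).
Qed.

Lemma word_sum_tuple N G : \sum_(t : N.-tuple X) G t = word_sum N G.
Proof.
elim: N G => [|N IH] G.
  rewrite (bigD1 [tuple]) //= big1 ?addr0 // => t /eqP[].
  exact: tuple0.
rewrite /= -(eq_bigr _ (fun x _ => IH _)) pair_big /=.
rewrite (reindex (fun p : X * N.-tuple X => [tuple of p.1 :: p.2])) //=.
exists (fun t : N.+1.-tuple X => (thead t, [tuple of behead t])).
  by case=> x t _; congr pair; apply: val_inj.
by move=> t _; rewrite -tuple_eta.
Qed.

Lemma word_sum_ffun N G :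
  \sum_(f : {ffun 'I_N -> X}) G [seq f i | i <- enum 'I_N] = word_sum N G.
Proof.
rewrite -word_sum_tuple (reindex (@tuple_of_finfun X N)) //=.
exists (@finfun_of_tuple X N) => ? _;
  [exact: tuple_of_finfunK | exact: finfun_of_tupleK].
Qed.

End WordSum.

Lemma risingS (y : int) a : rising y a.+1 = y * rising (y + 1) a.
Proof.
rewrite /rising big_nat_recl // addr0; congr (_ * _).
by apply: eq_bigr => i _; rewrite -addrA -intS.
Qed.

(** For [a > 0] both terms share the factor [rising (y + 1) a.-1], with cofactors [y + a] and [y].
    At [a = 0] the factor [a%:R] makes the truncated predecessor harmless. *)
Lemma rising_shift (y : int) a :
  rising (y + 1) a - rising y a = a%:R * rising (y + 1) a.-1.
Proof.
case: a => [|a]; first by rewrite /rising !big_geq // subrr mul0r.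
rewrite (risingS y) {1}/rising big_nat_recr //= -/(rising (y + 1) a).
by rewrite [_.+1%:R]mulrS; ring.
Qed.

(** * Weighted word polynomials and their shifts *)

Section Dragon.
Variable n : nat.
Notation X := {set 'I_n}.
Notation vec := {ffun X -> int}.
Implicit Types (I J U : X) (s t : seq X) (y : vec) (v w : seq X -> rat).

Definition unit_vec I : vec := [ffun J => (J == I)%:R].

(** The bracket at arbitrary integer values, without the shift by 1 at the full set; that shift is
    restored later as [unit_vec setT]. *)
Definition risings y s : rat := \prod_I (rising (y I) (count_mem I s))%:~R.

Lemma risings_nil y : risings y [::] = 1.
Proof. by rewrite /risings big1 // => I _; rewrite /rising big_geq. Qed.

Lemma perm_risings y s t : perm_eq s t -> risings y s = risings y t.
Proof. by move=> /permP st; apply: eq_bigr => I _; rewrite st. Qed.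

(** Only the factor of [I] changes, and [rem I s] lowers its exponent by one; if [I] is not in [s],
    both sides vanish. *)
Lemma risings_shift y I s :
  risings (y + unit_vec I) s - risings y s
  = (count_mem I s)%:R * risings (y + unit_vec I) (rem I s).
Proof.
pose rest y' s' : rat := \prod_(J | J != I) (rising (y' J) (count_mem J
  s'))%:~R.
have split_I y' s' :
    risings y' s' = (rising (y' I) (count_mem I s'))%:~R * rest y' s'.
  by rewrite /risings (bigD1 I).
have rest1 : rest (y + unit_vec I) s = rest y s.
  by apply: eq_bigr => J /negPf JI; rewrite !ffunE JI addr0.
have rest2 : rest (y + unit_vec I) (rem I s) = rest y s.
  apply: eq_bigr => J /negPf JI; rewrite !ffunE JI addr0.
  by rewrite count_rem /= eq_sym JI andbF subn0.
rewrite !split_I rest1 rest2 -mulrBl -rmorphB !ffunE eqxx rising_shift.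
rewrite rmorphM rmorph_nat mulrA; congr (_ * _ * _).
rewrite count_rem /= eqxx andbT.
by case: (boolP (I \in s)) => [_|/count_memPn->] /=; rewrite ?subn1.
Qed.

(** The factor [1 / N!] turns a shift of [y] into prepending a letter. All lengths below [n] occur,
    although the bracket sum has words of length [n.-1] only; [word_sum_shiftT] reconciles the
    two. *)
Definition word_poly v y : rat :=
  \sum_(N < n) (N`!%:R)^-1 * word_sum N (fun s => v s * risings y s).

Lemma word_polyB v w y :
  word_poly (fun s => v s - w s) y = word_poly v y - word_poly w y.
Proof.
rewrite -sumrB; apply: eq_bigr => N _; rewrite -mulrBr; congr (_ * _).
apply: etrans (word_sumB _ _ _).
by apply: eq_word_sum => s _; rewrite mulrBl.
Qed.

(** Vanishing on words of length at least [n] makes the cut at [N < n] harmless when a letter is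
    prepended. *)
Definition symmetric_weight v :=
  (forall s t, perm_eq s t -> v s = v t) /\
  (forall s, (n <= size s)%N -> v s = 0).

Lemma symmetric_weight_cons v I :
  symmetric_weight v -> symmetric_weight (fun s => v (I :: s)).
Proof.
case=> vP v0; split=> [s t st|s ns]; first by apply: vP; rewrite perm_cons.
by apply: v0 => /=; apply: leqW.
Qed.

Lemma symmetric_weightB v w : symmetric_weight v -> symmetric_weight w ->
  symmetric_weight (fun s => v s - w s).
Proof.
move=> [vP v0] [wP w0]; split=> [s t st|s ns];
  first by rewrite (vP s t) ?(wP s t).
by rewrite v0 ?w0 ?subrr.
Qed.

Lemma word_sum_shift N v y I : (forall s t, perm_eq s t -> v s = v t) ->
  word_sum N.+1 (fun s => v s * risings (y + unit_vec I) s)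
  = word_sum N.+1 (fun s => v s * risings y s)
    + N.+1%:R * word_sum N (fun s => v (I :: s) * risings (y + unit_vec I) s).
Proof.
move=> vP; apply/eqP; rewrite [X in _ == X]addrC -subr_eq -word_sumB; apply/eqP.
pose G s := v s * risings (y + unit_vec I) (rem I s).
transitivity (word_sum N.+1 (fun s => (count_mem I s)%:R * G s)).
  by apply: eq_word_sum => s _; rewrite -mulrBr risings_shift mulrCA.
rewrite word_sum_count; last first.
  move=> s t st; rewrite /G (vP _ _ st); congr (_ * _); apply: perm_risings.
  apply/permP => a; rewrite !count_rem (perm_mem st); congr (_ - _)%N.
  exact/permP.
by congr (_ * _); apply: eq_word_sum => s _; rewrite /G /= eqxx.
Qed.

(** The terms of length [N.+1] on the left yield the terms of length [N] of the prepended weight.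
    The surplus one, of length [n.-1], is zero because its weight is taken on words of length
    [n]. *)
Lemma word_poly_shift v y I : symmetric_weight v ->
  word_poly v (y + unit_vec I)
  = word_poly v y + word_poly (fun s => v (I :: s)) (y + unit_vec I).
Proof.
case=> vP v0; rewrite /word_poly.
pose a N := (N`!%:R)^-1 * word_sum N (fun s => v s * risings (y + unit_vec I)
  s).
pose b N := (N`!%:R)^-1 * word_sum N (fun s => v s * risings y s).
pose c N := (N`!%:R)^-1
  * word_sum N (fun s => v (I :: s) * risings (y + unit_vec I) s).
have a0 : a 0%N = b 0%N by rewrite /a /b /= !risings_nil.
have aS N : a N.+1 = b N.+1 + c N.
  rewrite /a /b /c word_sum_shift // mulrDr; congr (_ + _).
  by rewrite factS natrM invfM mulrACA mulVf ?pnatr_eq0 // mul1r.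
have sum_abc m : \sum_(N < m.+1) a N = \sum_(N < m.+1) b N + \sum_(N < m) c N.
  elim: m => [|m IH]; first by rewrite !big_ord_recl !big_ord0 a0 !addr0.
  by rewrite !(big_ord_recr m.+1) IH aS !(big_ord_recr m) /=; ring.
(* [n] also occurs in the type of the letters, so only the summation bound is generalized to [m]. *)
suff sum_n m : n = m ->
    \sum_(N < m) a N = \sum_(N < m) b N + \sum_(N < m) c N by exact: sum_n.
case: m => [|m] nm; first by rewrite !big_ord0 addr0.
rewrite sum_abc; congr (_ + _); rewrite big_ord_recr /=.
rewrite [c m]/c word_sum0 ?mulr0 ?addr0 // => s sz; rewrite v0 ?mul0r //.
by rewrite (leq_trans (eq_leq nm)) //= sz.
Qed.

End Dragon.

(** * Draconian families *)

Section Draconian.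
Variable n : nat.
Notation X := {set 'I_n}.
Notation vec := {ffun X -> int}.
Implicit Types (A B I J U : X) (s t : seq X) (y : vec) (v w : seq X -> rat).

Definition nb_inside s A : nat := count (fun I => I \subset A) s.

(** The dragon marriage condition stated over containing sets, the form suited to uncrossing. For
    [A] empty the bound is [0.-1 = 0], so the empty letter is excluded. *)
Definition draconian s : bool := [forall A : X, (nb_inside s A <= #|A|.-1)%N].

Definition drac_weight s : rat := (draconian s)%:R.

Definition drac_poly y : rat := word_poly drac_weight y.

Lemma nb_inside_cons I s A :
  nb_inside (I :: s) A = ((I \subset A) + nb_inside s A)%N.
Proof. by []. Qed.

(** A letter inside both sets lies in their intersection, and a letter inside either one lies in
    their union. *)
Lemma nb_inside_supermodular s A B :
  (nb_inside s A + nb_inside s B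
   <= nb_inside s (A :|: B) + nb_inside s (A :&: B))%N.
Proof.
elim: s => // I s IH; rewrite !nb_inside_cons subsetI.
have hA : I \subset A -> I \subset A :|: B.
  by move/subset_trans; apply; apply: subsetUl.
have hB : I \subset B -> I \subset A :|: B.
  by move/subset_trans; apply; apply: subsetUr.
by move: hA hB; case: (I \subset A); case: (I \subset B);
  case: (I \subset A :|: B) => // hA hB;
  do ?[by have := hA isT | by have := hB isT]; rewrite /=; lia.
Qed.

Lemma draconianP s :
  reflect (forall A, (nb_inside s A <= #|A|.-1)%N) (draconian s).
Proof. exact: forallP. Qed.

Lemma draconian_sub I J s :
  I \subset J -> draconian (I :: s) -> draconian (J :: s).
Proof.
move=> IJ /draconianP Is; apply/draconianP => A; apply: leq_trans (Is A).
rewrite !nb_inside_cons leq_add2r.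
by case: (boolP (J \subset A)) => // /(subset_trans IJ) ->.
Qed.

Lemma perm_draconian s t : perm_eq s t -> draconian s = draconian t.
Proof. by move=> /permP st; apply: eq_forallb => A; rewrite /nb_inside st. Qed.

Lemma draconianC I J s : draconian (I :: J :: s) = draconian (J :: I :: s).
Proof. by apply: perm_draconian; rewrite (perm_catCA [:: I] [:: J] s). Qed.

Lemma symmetric_drac_weight : (0 < n)%N -> symmetric_weight (n := n)
  drac_weight.
Proof.
move=> n_gt0; split=> [s t st|s ns];
  first by rewrite /drac_weight (perm_draconian st).
rewrite /drac_weight; case: draconianP => // /(_ setT).
rewrite cardsT card_ord /nb_inside (eq_count (a2 := predT)) => [|I]; last first.
  exact: subsetT.
by rewrite count_predT; lia.
Qed.

(** With [U] the union, the letters [I, J] are admissible iff both [I, U] and [J, U] are, and [U, U]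
    are admissible iff at least one of these pairs is. *)
Lemma drac_weight_modular I J s :
  drac_weight [:: I, J & s] + drac_weight [:: I :|: J, I :|: J & s]
  = drac_weight [:: I, I :|: J & s] + drac_weight [:: J, I :|: J & s].
Proof.
set U := I :|: J.
have IU : I \subset U := subsetUl I J.
have JU : J \subset U := subsetUr I J.
have both : draconian [:: I, J & s]
    = draconian [:: I, U & s] && draconian [:: J, U & s].
  apply/idP/andP => [IJs|[/draconianP Is /draconianP Js]].
    split; rewrite draconianC.
      by apply: draconian_sub JU _; rewrite draconianC.
    by apply: draconian_sub IU _.
  apply/draconianP => A; have := Is A; have := Js A.
  rewrite !nb_inside_cons subUset.
  by case: (I \subset A); case: (J \subset A) => /=; lia.
have either : draconian [:: U, U & s]
    = draconian [:: I, U & s] || draconian [:: J, U & s].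
  apply/idP/orP => [/draconianP UUs|[|]]; try exact: draconian_sub.
  (* If [A] and [B] refute the two families, neither contains [U], so [s] alone reaches [#|A|.-1]
     and [#|B|.-1] there; the two copies of [U] inside [A :|: B] then contradict
     [nb_inside_supermodular]. *)
  case: (boolP (draconian [:: I, U & s])) => [|/forallPn[A nA]]; first by left.
  right; apply/draconianP => B; rewrite leqNgt; apply/negP => nB.
  have tight (K A' : X) : K \subset U ->
      (#|A'|.-1 < nb_inside [:: K, U & s] A')%N ->
      K \subset A' /\ (#|A'|.-1 <= nb_inside s A')%N.
    move=> KU; have := UUs A'; rewrite !nb_inside_cons.
    case: (boolP (U \subset A')) => [/(subset_trans KU) -> /=|_]; first by lia.
    by case: (K \subset A') => /=; lia.
  case: (tight I A IU); rewrite ?ltnNge // => IA cA.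
  case: (tight J B JU nB) => JB cB.
  have := UUs (A :|: B); have := UUs (A :&: B).
  rewrite !nb_inside_cons (setUSS IA JB).
  by have := nb_inside_supermodular s A B; have := cardsUI A B; lia.
by rewrite /drac_weight both either; case: (draconian _); case: (draconian _).
Qed.

Lemma drac_weight_set1 i s : drac_weight ([set i] :: s) = 0.
Proof.
rewrite /drac_weight; case: draconianP => // /(_ [set i]).
by rewrite nb_inside_cons cards1 subxx.
Qed.

(** This is the modular identity for [U :\ i] and [[set i]], in which every family with the letter
    [[set i]] has weight zero. *)
Lemma drac_weight_dup U i s : i \in U ->
  drac_weight [:: U, U & s] = drac_weight [:: U :\ i, U & s].
Proof.
move=> Ui; have := drac_weight_modular (U :\ i) [set i] s.
rewrite setUC setD1K // !drac_weight_set1 addr0.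
by rewrite /drac_weight draconianC -/(drac_weight _) drac_weight_set1 add0r.
Qed.

Definition avoids i s : bool := all (fun I => i \notin I) s.

Lemma nb_inside_avoids i s A :
  avoids i s -> nb_inside s (A :\ i) = nb_inside s A.
Proof.
move=> /allP si; apply: eq_in_count => I /si iI.
by rewrite subsetD1 iI andbT.
Qed.

(** Since [s] avoids [i], its count in [A] is that in [A :\ i], whose bound is smaller by one; this
    leaves room for [U]. The condition [U != [set i]] keeps [A :\ i] nonempty. *)
Lemma drac_weight_avoids U i s : i \in U -> U != [set i] -> avoids i s ->
  drac_weight (U :: s) = drac_weight s.
Proof.
move=> Ui U1 si; rewrite /drac_weight; congr (_%:R); congr nat_of_bool.
apply/draconianP/draconianP => drac A.
  by apply: leq_trans (drac A); rewrite nb_inside_cons leq_addl.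
rewrite nb_inside_cons; case: (boolP (U \subset A)) => [UA|_]; last exact: drac.
have := drac (A :\ i); rewrite (nb_inside_avoids _ si).
have Ai : i \in A by apply: (subsetP UA).
have := cardsD1 i A; rewrite Ai /=.
have : (0 < #|A :\ i|)%N.
  rewrite card_gt0; apply: contra_neq U1 => A0; apply/eqP.
  by rewrite eqEsubset sub1set Ui andbT -setD_eq0 -subset0 -A0 setSD.
by move=> /=; lia.
Qed.

Lemma risings_eq0 I s y : I \in s -> y I = 0 -> risings y s = 0.
Proof.
move=> Is yI; rewrite /risings (bigD1 I) //= yI.
have : count_mem I s != 0%N by apply: contraL Is => /eqP /count_memPn.
by case: (count_mem I s) => // c _; rewrite risingS !mul0r.
Qed.

(** The value at [y + unit_vec I + unit_vec U] is expanded by [word_poly_shift] in both orders; a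
    difference of shifts becomes a difference of prepended letters. *)
Lemma word_poly_shiftB v y I U : symmetric_weight v ->
  word_poly v (y + unit_vec I) - word_poly v (y + unit_vec U)
  = word_poly (fun s => v (I :: s) - v (U :: s)) (y + unit_vec I + unit_vec U).
Proof.
move=> vS; rewrite word_polyB.
have := word_poly_shift (y + unit_vec I) U vS.
rewrite {1}addrAC (word_poly_shift (y + unit_vec U) I vS) (addrAC y (unit_vec
  U)).
move: (word_poly v (y + unit_vec I)) (word_poly v (y + unit_vec U)) => a b.
by move: (word_poly (fun s => v (I :: s)) _) => c; lra.
Qed.

(** * Exchange relations for the draconian polynomial *)

Section Relations.
Hypothesis n_gt0 : (0 < n)%N.
Let dS := symmetric_drac_weight n_gt0.

(** Applying [word_poly_shiftB] for [I] and then for [J] turns the double difference into a sum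
    whose weight vanishes by [drac_weight_modular]. *)
Lemma drac_poly_modular y I J (U := I :|: J) :
  drac_poly (y + unit_vec I + unit_vec J) + drac_poly (y + unit_vec U +
    unit_vec U)
  = drac_poly (y + unit_vec I + unit_vec U) + drac_poly (y + unit_vec J +
    unit_vec U).
Proof.
pose d s := drac_weight (I :: s) - drac_weight (U :: s).
have e1 := word_poly_shiftB (y + unit_vec J) I U dS.
have e2 := word_poly_shiftB (y + unit_vec U) I U dS.
have dSym : symmetric_weight d.
  by apply: symmetric_weightB; apply: symmetric_weight_cons.
have e3 := word_poly_shiftB (y + unit_vec I + unit_vec U) J U dSym.
have z : word_poly (fun s => d (J :: s) - d (U :: s))
    (y + unit_vec I + unit_vec U + unit_vec J + unit_vec U) = 0.
  rewrite /word_poly big1 // => N _; rewrite word_sum0 ?mulr0 // => s _.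
  have := drac_weight_modular I J s.
  rewrite -/U /d {1}[drac_weight [:: U, J & s]]/drac_weight draconianC.
  rewrite -/(drac_weight [:: J, U & s]).
  move: (drac_weight _) (drac_weight _) (drac_weight _) (drac_weight _).
  move=> {e1 e2 e3 dSym d} p q r t pqrt.
  apply/eqP; rewrite mulf_eq0; apply/orP; left; apply/eqP; lra.
move: e1 e2 e3; rewrite z -/d -!/(drac_poly _).
rewrite (addrAC y (unit_vec J) (unit_vec I)) (addrAC y (unit_vec U) (unit_vec
  I)).
rewrite (addrAC (y + unit_vec I) (unit_vec J) (unit_vec U)).
move: (drac_poly _) (drac_poly _) (drac_poly _) (drac_poly _) => a b c e.
by move: (word_poly d _) (word_poly d _) => r1 r2 e1 e2 e3; lra.
Qed.

Lemma drac_poly_set1 y i : drac_poly (y + unit_vec [set i]) = drac_poly y.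
Proof.
rewrite /drac_poly word_poly_shift // [X in _ + X](_ : _ = 0) ?addr0 //.
rewrite /word_poly big1 // => N _; rewrite word_sum0 ?mulr0 // => s _.
by rewrite drac_weight_set1 mul0r.
Qed.

Lemma drac_poly0 : drac_poly 0 = 1.
Proof.
rewrite /drac_poly /word_poly (bigD1 (Ordinal n_gt0)) //= risings_nil mulr1.
rewrite big1 ?addr0 => [|[[|N] lt_Nn] N_neq0].
- by rewrite invr1 mul1r /drac_weight; case: draconianP => // -[] A.
- by case/eqP: N_neq0; apply: val_inj.
rewrite (@word_sum0 _ N.+1) ?mulr0 // => -[|I s] // _.
by rewrite (risings_eq0 (mem_head I s)) ?mulr0 // ffunE.
Qed.

(** After one shift by [U], the prepended term may be moved from [y + unit_vec U] to
    [y + unit_vec (U :\ i)] by [drac_weight_dup]. There every coordinate at a set containing [i] is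
    zero, so only words avoiding [i] survive, and for them the extra letter [U] does not change the
    weight. *)
Lemma drac_poly_avoids y U i :
    (forall I, i \in I -> y I = 0) -> i \in U -> U != [set i] ->
  drac_poly (y + unit_vec U)
  = drac_poly (y + unit_vec (U :\ i)) + drac_poly y.
Proof.
move=> yi Ui U1; rewrite /drac_poly (word_poly_shift y U dS) addrC.
apply: (congr1 (fun c => c + word_poly drac_weight y)).
have dU := symmetric_weight_cons U dS.
have := word_poly_shiftB y U (U :\ i) dU.
rewrite [RHS](_ : _ = 0) => [/subr0_eq ->|]; last first.
  rewrite /word_poly big1 // => N _; rewrite word_sum0 ?mulr0 // => s _.
  rewrite (drac_weight_dup s Ui) -[X in _ - X]/((draconian _)%:R) draconianC.
  by rewrite subrr mul0r.
apply: eq_bigr => N _; congr (_ * _); apply: eq_word_sum => s _.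
case: (boolP (avoids i s)) => [si|]; first by rewrite (drac_weight_avoids Ui).
case/allPn => I Is; rewrite negbK => Ii.
rewrite (risings_eq0 Is) ?mulr0 // !ffunE yi // add0r.
by case: eqP Ii => // ->; rewrite !inE eqxx.
Qed.

End Relations.
End Draconian.

(** * The bracket sum as a polynomial *)

Section Bracket.
Variable n : nat.
Hypothesis n_gt0 : (0 < n)%N.
Notation X := {set 'I_n}.
Notation vec := {ffun X -> int}.
Implicit Types (A I J U : X) (s : seq X) (y : vec).

Definition word_of N (T : {ffun 'I_N -> X}) : seq X := [seq T i | i <- enum
  'I_N].

Lemma count_word_of N (T : {ffun 'I_N -> X}) (p : pred X) :
  count p (word_of T) = #|[set i | p (T i)]|.
Proof.
rewrite /word_of count_map -size_filter cardE enumT [in RHS]/enum_mem.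
by congr size; apply: eq_filter => i; rewrite /= inE.
Qed.

Lemma draconian_word_of (T : {ffun 'I_n.-1 -> X}) :
  draconian (word_of T) = dragon_marriage T.
Proof.
apply/draconianP/forallP => [drac K|dragon A].
  apply/implyP => K0; have := drac (\bigcup_(i in K) T i).
  rewrite /nb_inside count_word_of.
  have : (#|K| <= #|[set i | T i \subset \bigcup_(j in K) T j]|)%N.
    by apply/subset_leq_card/subsetP => i iK; rewrite inE; apply: bigcup_sup.
  by have := K0; rewrite -card_gt0; lia.
rewrite /nb_inside count_word_of; set K := [set i | _].
have [->|K0] := eqVneq K set0; first by rewrite cards0.
have leA : (#|\bigcup_(i in K) T i| <= #|A|)%N.
  by apply/subset_leq_card/bigcupsP => i; rewrite inE.
by have := leq_trans (implyP (dragon K) K0) leA; case: #|A|.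
Qed.

Lemma count_set0_draconian s : draconian s -> count_mem set0 s = 0%N.
Proof.
move=> /draconianP /(_ set0); rewrite cards0 leqn0 => /eqP <-.
by apply: eq_count => I; rewrite /= subset0.
Qed.

(** The bracket omits the empty set, whose factor in [risings] is 1 because a draconian word does
    not contain it. *)
Lemma bracketE (S : nat) (T : {ffun 'I_n.-1 -> X}) : dragon_marriage T ->
  (bracket S (monomial_of T))%:~R
  = risings ([ffun I => Ysub S I] + unit_vec setT) (word_of T).
Proof.
move=> dragon; have drac : draconian (word_of T) by rewrite draconian_word_of.
have monoE I : monomial_of T I = count_mem I (word_of T).
  by rewrite count_word_of.
have T0 : (set0 : X) != setT.
  by rewrite eq_sym -card_gt0 cardsT card_ord.
rewrite /risings (bigD1 setT) //= (bigD1 set0) //= (count_set0_draconian drac).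
rewrite {2}/rising big_geq // mul1r !ffunE eqxx rmorphM -monoE.
congr (_ * _); rewrite [LHS]rmorph_prod;
  apply: eq_big => [I|I /andP[_ /negPf IT]]; first exact: andbC.
by rewrite !ffunE IT addr0 monoE.
Qed.

(** The letter [setT] lies only inside [A = setT], where words of length below [n] respect the
    bound, so prepending it preserves admissibility. Each use of [word_sum_shift] then lowers the
    length by one and leaves one term of the sum. *)
Lemma word_sum_shiftT y k : (k < n)%N ->
  (k`!%:R)^-1 * word_sum k (fun s => drac_weight s * risings (y + unit_vec
    setT) s)
  = \sum_(N < k.+1) (N`!%:R)^-1
      * word_sum N (fun s => drac_weight s * risings y s).
Proof.
pose F N := (N`!%:R)^-1 * word_sum N (fun s => drac_weight s * risings y s).
rewrite -[RHS]/(\sum_(N < k.+1) F N).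
elim: k => [|k IH] lt_kn.
  by rewrite big_ord_recl big_ord0 addr0 /F /= !risings_nil.
rewrite word_sum_shift => [|s t /perm_draconian st]; last first.
  by rewrite /drac_weight st.
rewrite mulrDr -/(F k.+1) big_ord_recr /= -IH ?(ltnW lt_kn) //.
rewrite addrC; congr (_ + _).
rewrite factS natrM invfM mulrACA mulVf ?pnatr_eq0 // mul1r; congr (_ * _).
apply: eq_word_sum => s sz; congr (_ * _).
rewrite /drac_weight; congr (_%:R); congr nat_of_bool.
apply/draconianP/draconianP => drac A; have := drac A; rewrite nb_inside_cons.
  by lia.
case: (boolP (setT \subset A)) => //; rewrite subTset => /eqP -> _.
rewrite cardsT card_ord; have := count_size (fun I : X => I \subset setT) s.
by rewrite sz /nb_inside; lia.
Qed.

Lemma bracket_sum (S : nat) :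
  1 / ((n.-1)`!)%:Q *
    \sum_(T : {ffun 'I_n.-1 -> X} | dragon_marriage T) (bracket S (monomial_of
      T))%:Q
  = drac_poly ([ffun I => Ysub S I] : vec).
Proof.
set y : vec := [ffun I => Ysub S I].
transitivity (((n.-1)`!%:R)^-1 * word_sum n.-1
    (fun s => drac_weight s * risings (y + unit_vec setT) s)).
  rewrite mul1r -pmulrn; congr (_ * _); rewrite -word_sum_ffun big_mkcond /=.
  apply: eq_bigr => T _; rewrite -/(word_of T) /drac_weight draconian_word_of.
  by case: ifP => [/bracketE ->|_]; rewrite ?mul1r ?mul0r.
rewrite word_sum_shiftT ?ltn_predL //.
rewrite /drac_poly /word_poly.
by rewrite -(big_mkord xpredT (fun N => (N`!%:R)^-1
      * word_sum N (fun s => drac_weight s * risings y s))) prednK // big_mkord.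
Qed.

End Bracket.

(** * Uniqueness from the exchange relations *)

Section Uniqueness.
Variable n : nat.
Notation X := {set 'I_n}.
Notation vec := {ffun X -> int}.
Implicit Types (A B I J U V : X) (s t : seq X) (y : vec) (H : vec -> rat).

Definition lower y A : int := \sum_(I : X | I \subset A) y I.

Definition supermodular y := forall A B,
  lower y A + lower y B <= lower y (A :|: B) + lower y (A :&: B).

Lemma lower_shift y I A :
  lower (y + unit_vec I) A = lower y A + (I \subset A)%:R.
Proof.
rewrite /lower (eq_bigr (fun J => y J + (J == I)%:R)); last first.
  by move=> J _; rewrite !ffunE.
rewrite big_split /=; congr (_ + _).
case: (boolP (I \subset A)) => IA.
  by rewrite (bigD1 I) //= eqxx big1 // => J /andP[_ /negPf ->].
by rewrite big1 // => J JA; case: eqP JA IA => // -> ->.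
Qed.

Lemma supermodular0 : supermodular 0.
Proof. by move=> A B; rewrite /lower !big1 // => I _; rewrite ffunE. Qed.

Lemma supermodular_shift y I : supermodular y -> supermodular (y + unit_vec I).
Proof.
move=> sup A B; rewrite !lower_shift subsetI.
have hA : I \subset A -> I \subset A :|: B.
  by move/subset_trans; apply; apply: subsetUl.
have hB : I \subset B -> I \subset A :|: B.
  by move/subset_trans; apply; apply: subsetUr.
by have := sup A B; move: hA hB; case: (I \subset A); case: (I \subset B);
  case: (I \subset A :|: B) => // hA hB;
  do ?[by have := hA isT | by have := hB isT]; rewrite /=; lia.
Qed.

(** The relations are stated at supermodular [y], where integer points of the permutohedron can be
    uncrossed. *)
Definition modular_rel H := forall y I J (U := I :|: J), supermodular y ->
  H (y + unit_vec I + unit_vec J) + H (y + unit_vec U + unit_vec U)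
  = H (y + unit_vec I + unit_vec U) + H (y + unit_vec J + unit_vec U).

Definition loop_rel H := forall y i, supermodular y ->
  H (y + unit_vec [set i]) = H y.

Definition avoid_rel H := forall y U i, supermodular y -> y set0 = 0 ->
  (forall I, i \in I -> y I = 0) -> i \in U -> U != [set i] ->
  H (y + unit_vec U) = H (y + unit_vec (U :\ i)) + H y.

Definition vec_of s : vec := \sum_(I <- s) unit_vec I.

Lemma vec_of_cons I s : vec_of (I :: s) = vec_of s + unit_vec I.
Proof. by rewrite /vec_of big_cons addrC. Qed.

Lemma perm_vec_of s t : perm_eq s t -> vec_of s = vec_of t.
Proof. by move=> st; apply: perm_big. Qed.

Lemma supermodular_vec_of s : supermodular (vec_of s).
Proof.
elim: s => [|I s IH]; first by rewrite /vec_of big_nil; apply: supermodular0.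
by rewrite vec_of_cons; apply: supermodular_shift.
Qed.

Lemma vec_ofE s I : vec_of s I = (count_mem I s)%:R.
Proof.
elim: s => [|J s IH]; first by rewrite /vec_of big_nil ffunE.
by rewrite vec_of_cons !ffunE IH /= natrD addrC eq_sym.
Qed.

Definition chain s := {in s &, forall I J, (I \subset J) || (J \subset I)}.

Lemma count_lt (T : eqType) (a b : pred T) (r : seq T) x :
  {in r, subpred a b} -> x \in r -> b x -> ~~ a x -> (count a r < count b r)%N.
Proof.
move=> ab xr bx ax; have := count_predUI a (predI b (predC a)) r.
rewrite [count (predI a _) r](_ : _ = 0%N) ?addn0; last first.
  by rewrite -(count_pred0 r); apply: eq_count => z /=; case: (a z);
    rewrite ?andbF.
have -> : count (predU a (predI b (predC a))) r = count b r.
  by apply: eq_in_count => z /ab abz /=; case: (a z) abz => //= [->|_];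
    rewrite ?andbT.
move=> ->; rewrite -[ltnLHS]addn0 ltn_add2l -has_count.
by apply/hasP; exists x => //=; rewrite bx.
Qed.

(** [U] is the largest member and [i] an element of [U] lying in fewest members. If a member
    containing [i] missed some [j] of [U], every member containing [j] would contain it, so [j]
    would lie in strictly fewer members than [i]. *)
Lemma chain_top s : chain s -> set0 \notin s -> s != [::] ->
  exists U i, [/\ U \in s, i \in U &
    {in s, forall V, V \subset U /\ (i \in V -> V = U)}].
Proof.
move=> ch s0; case: s ch s0 => // U0 s' ch s0 _; set s := U0 :: s' in ch s0 *.
have U0s : U0 \in s by apply: mem_head.
case: (@arg_maxnP _ U0 (mem s) (fun U => #|U|) U0s) => U Us maxU.
have subU V : V \in s -> V \subset U.
  move=> Vs; case/orP: (ch _ _ Vs Us) => // UV.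
  have cVU : (#|V| <= #|U|)%N := maxU V Vs.
  suff -> : U = V by [].
  by apply/eqP; rewrite eqEcard UV cVU.
have [i0 Ui0] : exists i0, i0 \in U.
  by apply/set0Pn; apply: contraNneq s0 => <-.
case: (@arg_minnP _ i0 (mem U) (fun i => count (fun V : X => i \in V) s) Ui0).
move=> i Ui mini; exists U, i; split=> // V Vs; split; first exact: subU.
move=> iV; apply/eqP; rewrite eqEsubset subU //=; apply/subsetP => j Uj.
apply/negPn/negP => jV.
have : (count (fun V : X => i \in V) s <= count (fun V : X => j \in V) s)%N.
  exact: mini.
apply/negP; rewrite -ltnNge.
apply: (count_lt (x := V)) => // W Ws jW.
case/orP: (ch _ _ Vs Ws) => /subsetP sub; first exact: sub.
by rewrite (sub _ jW) in jV.
Qed.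

Definition total_card s : nat := \sum_(I <- s) #|I|.

Lemma perm_total_card s t : perm_eq s t -> total_card s = total_card t.
Proof. by move=> st; apply: perm_big. Qed.

Lemma total_card_cons I s : total_card (I :: s) = (#|I| + total_card s)%N.
Proof. by rewrite /total_card big_cons. Qed.

Section Vanishing.
Variable H : vec -> rat.
Hypotheses (Hmod : modular_rel H) (Hloop : loop_rel H) (Havoid : avoid_rel H).
Hypothesis H0 : H 0 = 0.

(** Induction on the total cardinality. With [U] and [i] from [chain_top], a singleton [U] is
    dropped by the loop relation, a repeated [U] is reduced by the modular relation, and a [U]
    occurring once by the avoidance relation. *)
Lemma vanish_chain s : chain s -> set0 \notin s -> H (vec_of s) = 0.
Proof.
have [m] := ubnP (total_card s); elim: m s => // m IH s lt_sm ch s0.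
have [->|s_neq0] := eqVneq s [::]; first by rewrite /vec_of big_nil.
have [U [i [Us Ui topU]]] := chain_top ch s0 s_neq0.
have [t st] : exists t, perm_eq s (U :: t) by exists (rem U s);
  apply: perm_to_rem.
have cU : #|U| = #|U :\ i|.+1 by rewrite (cardsD1 i) Ui.
have Us' : {subset t <= s} by move=> V Vt; rewrite (perm_mem st) inE Vt orbT.
(* Adding [U :\ i] keeps a chain, because a member of [s] either equals [U] or lies in [U :\ i]. *)
have IH' s' : {subset s' <= U :\ i :: s} -> U != [set i] ->
    (total_card s' < total_card s)%N -> H (vec_of s') = 0.
  move=> sub U1 lt_s'; apply: IH; first by apply: leq_trans lt_s' _.
    have cmp V : V \in s -> (V \subset U :\ i) || (U :\ i \subset V).
      move=> Vs; have [VU iV] := topU V Vs; rewrite subsetD1 VU /=.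
      by case: (boolP (i \in V)) => //= /iV ->; rewrite subD1set.
    move=> I J /sub; rewrite inE => /predU1P[->|Is] /sub.
      rewrite inE => /predU1P[->|Js]; first by rewrite subxx.
      by rewrite orbC cmp.
    rewrite inE => /predU1P[->|Js]; first exact: cmp.
    exact: ch.
  apply/negP => /sub; rewrite inE (negPf s0) orbF => /eqP e0.
  by case/eqP: U1; rewrite -(setD1K Ui) -e0 setU0.
rewrite (perm_vec_of st); have := perm_total_card st.
rewrite total_card_cons => eq_s.
have [U1|U1] := eqVneq U [set i].
  rewrite vec_of_cons U1 Hloop; last exact: supermodular_vec_of.
  apply: IH; first by rewrite eq_s cU in lt_sm; lia.
    by move=> I J /Us' Is /Us' Js; apply: ch.
  by apply: contra s0 => /Us'.
case: (boolP (U \in t)) => [Ut|Ut].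
  have [t' tt'] : exists t', perm_eq t (U :: t') by exists (rem U t);
    apply: perm_to_rem.
  have := perm_total_card tt'; rewrite total_card_cons => eq_t.
  rewrite vec_of_cons (perm_vec_of tt') vec_of_cons.
  have sy := supermodular_vec_of t'.
  (* Once the loops are removed, this relation expresses the value at two copies of [U] through
     values at smaller total cardinality. *)
  have := Hmod (U :\ i) [set i] sy.
  rewrite setUC setD1K // Hloop; last exact: supermodular_shift.
  rewrite (addrAC _ (unit_vec [set i])) Hloop; last exact: supermodular_shift.
  rewrite -!vec_of_cons.
  have t's : {subset t' <= s}.
    by move=> V Vt'; apply: Us'; rewrite (perm_mem tt') inE Vt' orbT.
  have sub1 : {subset U :\ i :: t' <= U :\ i :: s}.
    move=> V; rewrite !inE => /orP[->//|/t's ->]; exact: orbT.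
  have sub2 : {subset U :: t' <= U :\ i :: s}.
    by move=> V; rewrite !inE => /predU1P[->|/t's ->]; rewrite ?Us orbT.
  have sub3 : {subset U :: U :\ i :: t' <= U :\ i :: s}.
    move=> V; rewrite inE => /predU1P[->|]; last exact: sub1.
    by rewrite inE Us orbT.
  rewrite (IH' _ sub1 U1) ?(IH' _ sub2 U1) ?(IH' _ sub3 U1) ?add0r //;
    rewrite ?total_card_cons; lia.
rewrite vec_of_cons (Havoid (i := i)) //; last 3 first.
- exact: supermodular_vec_of.
- rewrite vec_ofE; apply/eqP; rewrite pnatr_eq0.
  by apply/eqP/count_memPn; apply: contra s0 => /Us'.
- move=> I iI; rewrite vec_ofE; apply/eqP; rewrite pnatr_eq0.
  apply/eqP/count_memPn; apply: contra Ut => It.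
  by have [_ /(_ iI) <-] := topU I (Us' I It).
rewrite -!vec_of_cons !IH' ?addr0 //.
- by move=> V /Us' Vs; rewrite inE Vs orbT.
- lia.
- by move=> V; rewrite !inE => /orP[->//|/Us' ->]; rewrite orbT.
- by rewrite total_card_cons; lia.
Qed.

End Vanishing.
End Uniqueness.

(** * From chains to arbitrary supermodular vectors *)

Section SignedVanishing.
Variable n : nat.
Notation X := {set 'I_n}.
Notation vec := {ffun X -> int}.
Implicit Types (A B I J U V : X) (s t : seq X) (y : vec) (H : vec -> rat).

(** The modular relation trades incomparable [I] and [J] for families with as many letters and
    larger total cardinality. That total is at most [size s * n], so the induction is on the gap and
    ends at chains. *)
Lemma vanish_list H s :
    modular_rel H -> loop_rel H -> avoid_rel H -> H 0 = 0 ->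
  set0 \notin s -> H (vec_of s) = 0.
Proof.
move=> Hmod Hloop Havoid H0.
have [m] := ubnP (size s * n - total_card s); elim: m s => // m IH s lt_sm s0.
case: (boolP (all2rel (fun I J : X => (I \subset J) || (J \subset I)) s)).
  by move/allrelP => ch; apply: vanish_chain => // I J Is Js; apply: ch.
case/allPn => I Is /allPn[J Js]; rewrite negb_or => /andP[nIJ nJI].
have [t st] : exists t, perm_eq s (I :: J :: t).
  have JsI : J \in rem I s.
    have := Js; rewrite (perm_mem (perm_to_rem Is)) inE => /predU1P[JI|//].
    by rewrite JI subxx in nIJ.
  exists (rem J (rem I s)); apply: perm_trans (perm_to_rem Is) _.
  by rewrite perm_cons perm_to_rem.
set U := I :|: J.
have I0 : I != set0 by apply: contraNneq s0 => <-.
have J0 : J != set0 by apply: contraNneq s0 => <-.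
have U0 : U != set0 by rewrite setU_eq0 negb_and I0.
have t0 : set0 \notin t.
  by apply: contra s0 => t0; rewrite (perm_mem st) !inE t0 !orbT.
have cI : (#|I| < #|U|)%N.
  apply: proper_card; rewrite properE subsetUl /=.
  by apply: contra nJI; apply: subset_trans; apply: subsetUr.
have cJ : (#|J| < #|U|)%N.
  apply: proper_card; rewrite properE subsetUr /=.
  by apply: contra nIJ; apply: subset_trans; apply: subsetUl.
have card_le V : (#|V| <= n)%N.
  by rewrite -[leqRHS]card_ord max_card.
have total_le (r : seq X) : (total_card r <= size r * n)%N.
  elim: r => [|V r IHr]; first by rewrite /total_card big_nil.
  by rewrite total_card_cons /= mulSn leq_add.
have IH' V W : V != set0 -> W != set0 -> (#|I| + #|J| < #|V| + #|W|)%N ->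
    H (vec_of [:: V, W & t]) = 0.
  move=> V0 W0 lt_VW; apply: IH; last first.
    by rewrite !inE !negb_or eq_sym V0 eq_sym W0.
  have := total_le [:: V, W & t].
  rewrite (perm_total_card st) (perm_size st) in lt_sm.
  move: lt_sm lt_VW; rewrite !total_card_cons /=; clear; lia.
have := Hmod _ I J (supermodular_vec_of t); rewrite -/U.
have [lt_UU lt_UJ lt_UI] : [/\ #|I| + #|J| < #|U| + #|U|,
    #|I| + #|J| < #|U| + #|J| & #|I| + #|J| < #|U| + #|I|]%N.
  split; last by rewrite [ltnRHS]addnC ltn_add2l.
    by rewrite -addSn leq_add // ltnW.
  by rewrite ltn_add2r.
rewrite -!vec_of_cons (perm_vec_of st) (IH' U U) // (IH' U J) // (IH' U I) //.
have -> : vec_of [:: I, J & t] = vec_of [:: J, I & t].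
  by apply: perm_vec_of; rewrite (perm_catCA [:: I] [:: J] t).
by rewrite !addr0.
Qed.

Lemma modular_relB H1 H2 :
  modular_rel H1 -> modular_rel H2 -> modular_rel (fun y => H1 y - H2 y).
Proof.
move=> mod1 mod2 y I J U sy; rewrite addrACA -opprD mod1 // mod2 //.
by rewrite opprD addrACA.
Qed.

Lemma loop_relB H1 H2 :
  loop_rel H1 -> loop_rel H2 -> loop_rel (fun y => H1 y - H2 y).
Proof. by move=> loop1 loop2 y i sy; rewrite loop1 ?loop2. Qed.

Lemma avoid_relB H1 H2 :
  avoid_rel H1 -> avoid_rel H2 -> avoid_rel (fun y => H1 y - H2 y).
Proof.
move=> avoid1 avoid2 y U i sy y0 yi Ui U1.
by rewrite (avoid1 _ _ _ sy y0 yi) // (avoid2 _ _ _ sy y0 yi) // opprD addrACA.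
Qed.

Lemma supermodular_shiftn I k y :
  supermodular y -> supermodular (y + unit_vec I *+ k).
Proof.
elim: k y => [|k IHk] y sy; first by rewrite addr0.
by rewrite mulrS addrA; apply/IHk/supermodular_shift.
Qed.

(* With [K y = H (y + e_I) - H y] and [I = i |: I'], the relations give
   [K (y + e_I) = K (y + e_I')], so [K] inherits the hypothesis for [I']. *)
Lemma vanish_backward H I y : modular_rel H -> loop_rel H -> I != set0 ->
    supermodular y ->
  (forall k, H (y + unit_vec I *+ k.+1) = 0) -> H y = 0.
Proof.
have [m] := ubnP #|I|; elim: m H I y => // m IH H I y lt_Im Hmod Hloop I0 sy Hk.
have [i Ii] := set0Pn _ I0.
have [I1|I1] := eqVneq I [set i].
  by rewrite -(Hloop y i sy) -I1 -[unit_vec I]mulr1n.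
pose K z := H (z + unit_vec I) - H z.
have Kloop : loop_rel K.
  move=> z j sz; rewrite /K (Hloop _ _ sz) (addrAC z (unit_vec [set j])).
  by rewrite Hloop //; apply: supermodular_shift.
have Kmod : modular_rel K.
  move=> z A B U sz; rewrite /K addrACA -opprD (Hmod z A B sz).
  have swap A' B' : z + unit_vec A' + unit_vec B' + unit_vec I
      = z + unit_vec I + unit_vec A' + unit_vec B'.
    by rewrite (addrAC _ (unit_vec B')) (addrAC z (unit_vec A')).
  rewrite !swap (Hmod _ A B (supermodular_shift I sz)) -/U.
  by rewrite opprD [LHS]addrACA.
have Kshift z : supermodular z ->
    K (z + unit_vec I) = K (z + unit_vec (I :\ i)).
  move=> sz; have := Hmod z (I :\ i) [set i] sz; rewrite setUC (setD1K Ii).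
  rewrite (Hloop _ _ (supermodular_shift _ sz)) (addrAC z (unit_vec [set i])).
  rewrite (Hloop _ _ (supermodular_shift _ sz)) => eqH.
  have lin (a b c d : rat) : a + b = c + d -> b - d = c - a by clear; lra.
  by rewrite /K; apply: lin.
have Kshifts k z : supermodular z ->
    K (z + unit_vec (I :\ i) *+ k) = K (z + unit_vec I *+ k).
  elim: k z => [|k IHk] z sz; first by rewrite !addr0.
  rewrite mulrSr addrA -(Kshift _ (supermodular_shiftn _ _ sz)).
  by rewrite addrAC IHk ?mulrS ?addrA //; apply: supermodular_shift.
(* The induction hypothesis is applied to [K] and [I :\ i]; each value it requires is a value of [K]
   along [unit_vec I], hence a difference of two zeros. *)
have Ky : K y = 0.
  apply: (IH K (I :\ i)) => //.
  - by move: lt_Im; rewrite (cardsD1 i I) Ii add1n ltnS.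
  - apply: contra_neq I1 => I'0; by rewrite -(setD1K Ii) I'0 setU0.
  - move=> k; rewrite Kshifts // /K -addrA -mulrSr !Hk subrr //.
by move: Ky; rewrite /K -[unit_vec I]mulr1n Hk; lra.
Qed.

(** The total deficit below zero, the measure by which negative coordinates are removed. *)
Definition neg_part y : nat := \sum_I `|Num.min (y I) 0|%N.

Lemma shiftnE y I k J :
  (y + unit_vec I *+ k) J = y J + (if J == I then k%:R else 0).
Proof.
elim: k => [|k IH]; first by rewrite addr0; case: eqP; rewrite addr0.
rewrite mulrSr addrA ffunE IH ffunE -addrA; congr (_ + _).
by case: eqP => _; rewrite ?addr0 // -natrD addn1.
Qed.

Lemma neg_part_shiftn y I k :
  y I < 0 -> (neg_part (y + unit_vec I *+ k.+1)%R < neg_part y)%N.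
Proof.
move=> yI; rewrite /neg_part [ltnLHS](bigD1 I) //= [ltnRHS](bigD1 I) //=.
rewrite -addSn leq_add //.
  rewrite shiftnE eqxx (min_l (ltW yI)) natz.
  by rewrite minElt; case: ifP; lia.
rewrite leq_eqVlt; apply/orP; left; apply/eqP; apply: eq_bigr => J /negPf JI.
by rewrite shiftnE JI addr0.
Qed.

Lemma supermodular_vanish H y :
    modular_rel H -> loop_rel H -> avoid_rel H -> H 0 = 0 ->
    supermodular y -> y set0 = 0 ->
  H y = 0.
Proof.
move=> Hmod Hloop Havoid H0; have [m] := ubnP (neg_part y).
elim: m y => // m IH y lt_ym sy y0.
have [/existsP[I yI]|/existsPn y_ge0] := boolP [exists I, y I < 0].
  have I0 : I != set0 by apply: contraTneq yI => ->; rewrite y0.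
  apply: (vanish_backward Hmod Hloop I0 sy) => k; apply: IH.
  - exact: leq_trans (neg_part_shiftn k yI) _.
  - exact: supermodular_shiftn.
  - by rewrite shiftnE y0 eq_sym (negPf I0).
(* A nonnegative [y] is the vector of the family with [y J] copies of each [J]; [y set0 = 0] keeps
   the empty set out of it. *)
pose s := flatten [seq nseq `|y J|%N J | J <- enum {: X}].
have count_s I : count_mem I s = `|y I|%N.
  rewrite count_flatten -map_comp sumnE big_map big_enum (bigD1 I) //=.
  rewrite count_nseq /= eqxx mul1n big1 ?addn0 // => J /negPf JI.
  by rewrite count_nseq /= JI.
have -> : y = vec_of s.
  apply/ffunP => I; rewrite vec_ofE count_s.
  by have := y_ge0 I; rewrite -leNgt => /gez0_abs; rewrite natz => ->.
apply: vanish_list => //.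
by apply/count_memPn; rewrite count_s y0.
Qed.

End SignedVanishing.

(** * The coordinates of the slice *)

Section SubsetSums.
Variable V : zmodType.
Implicit Types (f g : nat -> V).

(** The binomial transform $\sum_j \binom{k}{j} g(j)$, in the form of Pascal's recursion. *)
Fixpoint binom_sum g k : V :=
  if k is k'.+1 then binom_sum g k' + binom_sum (fun j => g j.+1) k' else g 0%N.

Lemma eq_binom_sum f g k : f =1 g -> binom_sum f k = binom_sum g k.
Proof.
elim: k f g => [|k IH] f g fg /=; first exact: fg.
by rewrite (IH f g) // (IH (fun j => f j.+1) (fun j => g j.+1)) // => j.
Qed.

Lemma binom_sumB f g k :
  binom_sum (fun j => f j - g j) k = binom_sum f k - binom_sum g k.
Proof.
elim: k f g => [|k IH] f g //=.
by rewrite IH (IH (fun j => f j.+1) (fun j => g j.+1)) opprD addrACA.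
Qed.

(** Subsets are split by whether they contain a chosen element, which is Pascal's recursion. *)
Lemma sum_subsets (T : finType) g (A : {set T}) :
  \sum_(I : {set T} | I \subset A) g #|I| = binom_sum g #|A|.
Proof.
move: {2}#|A| (erefl #|A|) => k.
elim: k g A => [|k IH] g A cA.
  move/eqP: cA; rewrite cards_eq0 => /eqP ->; rewrite cards0 /=.
  by rewrite (big_pred1 set0) ?cards0 // => I; rewrite subset0.
have [i Ai] : exists i, i \in A by apply/set0Pn; rewrite -card_gt0 cA.
have cAi : #|A :\ i| = k by have := cardsD1 i A; rewrite Ai cA add1n => -[].
rewrite (bigID (fun I : {set T} => i \in I)) /= addrC cA /= -cAi.
rewrite -!IH //; congr (_ + _).
  by apply: eq_bigl => I; rewrite subsetD1.
rewrite (reindex_onto (fun I => i |: I) (fun I => I :\ i)) /=; last first.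
  by move=> I /andP[_ iI]; rewrite setD1K.
apply: eq_big => I; last first.
  case/andP=> _ /eqP eI; have iI : i \notin I by rewrite -eI setD11.
  by rewrite cardsU1 iI.
rewrite setU11 andbT subUset sub1set Ai /= subsetD1.
case: (boolP (i \in I)) => iI; last by rewrite setU1K // eqxx.
rewrite andbF; apply/negP => /andP[_ /eqP eI].
by move: iI; rewrite -eI setD11.
Qed.

(** The iterated forward difference $\Delta^j f(a)$. *)
Fixpoint diff f j a : V := if j is j'.+1 then diff f j' a.+1 - diff f j' a else
  f a.

(** Newton's forward difference formula. *)
Lemma binom_sum_diff f k a : binom_sum (fun j => diff f j a) k = f (a + k)%N.
Proof.
elim: k a => [|k IH] a /=; first by rewrite addn0.
rewrite (binom_sumB (fun j => diff f j a.+1) (fun j => diff f j a)).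
by rewrite !IH addrC subrK addSnnS.
Qed.

End SubsetSums.

Lemma diffE (f : nat -> int) j a :
  diff f j a = \sum_(0 <= i < j.+1) (-1) ^+ i * ('C(j, i))%:Z * f (a + j - i)%N
    :> int.
Proof.
elim: j a => [|j IH] a.
  by rewrite big_nat1 bin0 expr0 !mul1r addn0 subn0.
rewrite /= !IH [RHS]big_nat_recl // expr0 bin0 !mul1r subn0.
transitivity (\sum_(0 <= i < j.+2) (-1) ^+ i * ('C(j, i))%:Z * f (a.+1 + j -
  i)%N
   - \sum_(0 <= i < j.+1) (-1) ^+ i * ('C(j, i))%:Z * f (a + j - i)%N).
  by rewrite (big_nat_recr j.+1) //= bin_small // mulr0 mul0r addr0.
rewrite [X in X - _]big_nat_recl // expr0 bin0 !mul1r subn0.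
rewrite addSnnS -addrA; congr (_ + _).
rewrite -sumrB; apply: eq_bigr => i _.
rewrite binS PoszD exprS addnS subSS; ring.
Qed.

(** * The vector x and its partial sums *)

Section ParkingCoordinates.
Variables n S : nat.

Definition xsum j : nat := \sum_(1 <= i < j.+1) xcoord n S i.

(** At [n - c] this is the sum of the [c] largest values, the bound for any [c] coordinates in the
    parking polytope. *)
Definition tail_sum j : nat := \sum_(j.+1 <= i < n.+1) i.

Lemma xsumS j : xsum j.+1 = (xsum j + xcoord n S j.+1)%N.
Proof. by rewrite /xsum big_nat_recr. Qed.

Lemma xsum0 : xsum 0 = 0%N.
Proof. by rewrite /xsum big_geq. Qed.

Lemma tail_sumS j : (j < n)%N -> tail_sum j = (j.+1 + tail_sum j.+1)%N.
Proof. by move=> jn; rewrite /tail_sum big_ltn. Qed.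

Lemma tail_sumn : tail_sum n = 0%N.
Proof. by rewrite /tail_sum big_geq. Qed.

Lemma tail_sum0 : tail_sum 0 = (n * n.+1)./2.
Proof.
have := bin2_sum n.+1; rewrite big_ltn // add0n /tail_sum => ->.
by rewrite bin2 mulnC.
Qed.

(** [ycoord n S j.+1] is the [j]-th forward difference of [xcoord] at 1, so raising [#|A|] from [k]
    to [k.+1] adds $x_{k+1}$ by Newton's formula. *)
Lemma lower_Ysub (A : {set 'I_n}) :
  lower [ffun I => Ysub S I] A = (xsum #|A|)%:Z.
Proof.
rewrite /lower (eq_bigr (fun I : {set 'I_n} => ycoord n S #|I|)); last first.
  by move=> I _; rewrite ffunE.
rewrite (sum_subsets (ycoord n S)); elim: #|A| => [|k IH].
  by rewrite xsum0 /= /ycoord big_geq.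
rewrite /= IH xsumS PoszD; congr (_ + _).
rewrite -(add1n k) -(binom_sum_diff (fun i => (xcoord n S i)%:Z)).
apply: eq_binom_sum => j; rewrite diffE /ycoord /=.
by apply: eq_bigr => i _; rewrite add1n.
Qed.

Lemma xcoord_mono i : (xcoord n S i <= xcoord n S i.+1)%N.
Proof.
rewrite /xcoord; case: ifP => // _; case: pickP => // -[r k] /= /and3P[_ rk _].
by repeat case: ifP; lia.
Qed.

(** The increments of [xsum] are the values of [xcoord], which increase weakly. *)
Lemma xsum_convex v b d : (v <= b)%N ->
  (xsum (v + d) + xsum b <= xsum (b + d) + xsum v)%N.
Proof.
have mono a c : (a <= c)%N -> (xcoord n S a <= xcoord n S c)%N.
  elim: c => [|c IH]; first by rewrite leqn0 => /eqP ->.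
  rewrite leq_eqVlt => /predU1P[->//|/IH ac];
    exact: leq_trans ac (xcoord_mono c).
move=> vb; elim: d => [|d IH]; first by rewrite !addn0 addnC.
rewrite !addnS !xsumS; have : (v + d < (b + d).+1)%N by rewrite ltnS leq_add2r.
by move/mono; lia.
Qed.

(** [lower] is here a convex function of the cardinality, and such a function is supermodular. *)
Lemma supermodular_Ysub : supermodular [ffun I : {set 'I_n} => Ysub S I].
Proof.
move=> A B; rewrite !lower_Ysub -!PoszD lez_nat.
have cIB : (#|A :&: B| <= #|B|)%N by apply/subset_leq_card/subsetIr.
have cIA : (#|A :&: B| <= #|A|)%N by apply/subset_leq_card/subsetIl.
have := xsum_convex (#|A| - #|A :&: B|) cIB; rewrite subnKC //.
suff -> : (#|B| + (#|A| - #|A :&: B|) = #|A :|: B|)%N by [].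
by rewrite addnBA // addnC cardsU.
Qed.

Hypothesis nS : (n <= S <= (n * n.+1)./2)%N.

Lemma rk_exists : S != n -> exists rk : 'I_n.+1 * 'I_n.+1, rk_spec n S rk.1
  rk.2.
Proof.
move=> Sn; case/andP: nS => nS1 nS2.
(* [k] ones followed by [k.+1, ..., n] sum to [k + tail_sum k]. The largest [k] for which this
   reaches [S] is taken; [Q k] then gives [r <= k.+1] and maximality gives [r >= 2]. *)
pose Q k := (S <= k + tail_sum k)%N.
have Q1 : exists k, (0 < k <= n)%N && Q k.
  have n_gt0 : (0 < n)%N by case: (n) nS1 nS2 Sn => //; case: (S).
  by exists 1%N; rewrite n_gt0 /Q; move: nS2; rewrite -tail_sum0 tail_sumS.
have Qmax k : (0 < k <= n)%N && Q k -> (k <= n)%N by case/andP=> /andP[].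
case: (ex_maxnP Q1 Qmax) => k /andP[/andP[k_gt0 k_le] Qk] max_k.
have k_lt : (k < n)%N.
  rewrite ltn_neqAle k_le andbT; apply/eqP => kn.
  by move: Qk; rewrite /Q kn tail_sumn; lia.
have nQ : ~~ Q k.+1.
  by apply/negP => QS; have := max_k k.+1; rewrite QS k_lt => /(_ isT); lia.
move: Qk nQ; rewrite /Q tail_sumS // => Qk nQ.
pose r := (S - k - tail_sum k.+1)%N.
have r_lt : (r < n.+1)%N by rewrite /r; lia.
exists (Ordinal r_lt, Ordinal (ltnW k_lt : k < n.+1)%N).
rewrite /rk_spec /= -/(tail_sum k.+1) /r; apply/and3P; split; lia.
Qed.

(** The case [S = n] is absorbed as [k = n], with [r = 1] as a dummy value. *)
Lemma xcoord_cases : exists r k, [/\ (0 < r <= k.+1)%N,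
   (k < n)%N && (k + r + tail_sum k.+1 == S)%N || (k == n) && (S == n) &
   forall i, (i <= n)%N ->
     xcoord n S i = if (i <= k)%N then 1%N else if i == k.+1 then r else i].
Proof.
have [Sn|Sn] := boolP (S == n).
  exists 1%N, n; rewrite eqxx /= orbT; split=> // i i_le.
  by rewrite /xcoord Sn i_le.
rewrite /xcoord (negPf Sn); case: pickP => [[r k] /= /and3P[k_n r_k rkS]|no_rk].
  exists r, k; split=> //; first lia.
  by apply/orP; left; apply/andP; split=> //; lia.
by have [rk] := rk_exists Sn; rewrite no_rk.
Qed.

Lemma tail_sum_step j : (j < n)%N -> (j.+1 + tail_sum j.+1 <= j + tail_sum j)%N.
Proof. by move=> jn; rewrite (tail_sumS jn); lia. Qed.

(** Up to index [k] the entries are ones, and beyond it the entries still to come are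
    [j.+1, ..., n]. Together the clauses say that [xsum j] is the maximum of [j] and
    [S - tail_sum j], the lower bound that the parking inequalities and the total [S] force on [j]
    coordinates. *)
Lemma xsum_cases j : (j <= n)%N ->
  [/\ (j <= xsum j)%N, (S <= xsum j + tail_sum j)%N &
      xsum j = j \/ xsum j + tail_sum j = S]%N.
Proof.
have [r [k [r_k kS xE]]] := xcoord_cases.
have small i : (i <= n)%N -> (i <= k)%N -> xsum i = i.
  elim: i => [|i IH] i_n i_k; first exact: xsum0.
  by rewrite xsumS xE // i_k IH ?(ltnW i_k) ?(ltnW i_n) // addn1.
have leS : (S <= k + tail_sum k)%N.
  case/orP: kS => [/andP[kn /eqP <-]|/andP[/eqP -> /eqP ->]].
    by rewrite (tail_sumS kn); lia.
  by rewrite leq_addr.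
have large d : (k + d.+1 <= n)%N ->
    (xsum (k + d.+1) + tail_sum (k + d.+1) = S)%N.
  elim: d => [|d IH] kd.
    rewrite addn1 in kd *; rewrite xsumS small ?(ltnW kd) // xE //.
    rewrite ltnn eqxx; case/orP: kS => [/andP[_ /eqP//]|/andP[/eqP kn _]].
    by rewrite kn ltnn in kd.
  rewrite -(IH _); last by lia.
  rewrite (addnS k d.+1) xsumS xE; last by lia.
  rewrite (tail_sumS (_ : k + d.+1 < n)%N); last by lia.
  by repeat case: ifP; lia.
have small_tail d : (d <= k)%N -> (k <= n)%N -> (S <= k - d + tail_sum (k -
  d))%N.
  elim: d => [|d IH] d_k k_n; first by rewrite subn0.
  apply: leq_trans (IH (ltnW d_k) k_n) _.
  have -> : (k - d = (k - d.+1).+1)%N by lia.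
  by apply: tail_sum_step; lia.
move=> j_n; have [j_k|k_j] := leqP j k.
  rewrite small //; split=> //; last by left.
  by have := small_tail (k - j)%N; rewrite subKn // leq_subr; apply=> //; lia.
have := large (j - k.+1)%N; rewrite addnS -addSn subnKC // => /(_ j_n) jS.
split; [|by rewrite jS|by right].
elim: j j_n {k_j jS} => [|j IH] // j_n.
have le_j := IH (ltnW j_n); case/andP: r_k => r_gt0 _.
by rewrite xsumS xE //; repeat case: ifP; lia.
Qed.

Lemma xsum_n : xsum n = S.
Proof.
have := xsum_cases (leqnn n); rewrite tail_sumn !addn0 => -[_ leS [xn|//]].
by case/andP: nS => n_le _; lia.
Qed.

End ParkingCoordinates.

(** * Parking functions and partial sums *)

Section ParkingInequalities.
Variable n : nat.
Implicit Types (A B : {set 'I_n}) (a : 'I_n -> nat).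

Lemma sum_ltn N c : (\sum_(m < N) (m < c) = minn c N)%N.
Proof.
elim: N => [|N IH]; first by rewrite big_ord0 minn0.
by rewrite big_ord_recr /= IH; lia.
Qed.

Lemma tail_sum_sub c :
  (c < n)%N -> tail_sum n (n - c.+1) = (n - c + tail_sum n (n - c))%N.
Proof.
move=> c_n; rewrite (tail_sumS (_ : n - c.+1 < n)%N); last by lia.
by rewrite (_ : (n - c.+1).+1 = n - c)%N //; lia.
Qed.

(** Level counting: among the [c] largest values, [minn c (n - m)] exceed [m]. *)
Lemma sum_minn c : (c <= n)%N ->
  (\sum_(m < n) minn c (n - m) = tail_sum n (n - c))%N.
Proof.
elim: c => [|c IH] c_n.
  by rewrite subn0 tail_sumn big1 // => m _; rewrite min0n.
rewrite tail_sum_sub // -(IH (ltnW c_n)) (eq_bigr (fun m : 'I_n => minn c (n -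
  m) + (m < n - c))%N).
  rewrite big_split /= addnC; congr (_ + _)%N.
  by rewrite sum_ltn; apply/minn_idPl; rewrite leq_subr.
by move=> m _; have := ltn_ord m; lia.
Qed.

Lemma count_gt_parking (t : n.-tuple nat) m :
  parking_function t -> (m < n)%N -> (count (fun x => m < x) t <= n - m)%N.
Proof.
case=> _ sort_le m_n;
  have /permP <- : perm_eq (sort leq t) t by rewrite perm_sort.
set s := sort leq t; have ss : size s = n by rewrite size_sort size_tuple.
rewrite -(cat_take_drop m s) count_cat.
have -> : count (fun x => m < x)%N (take m s) = 0%N.
  apply/eqP; rewrite -leqn0 leqNgt -has_count; apply/hasPn => x.
  case/(nthP 0%N) => i; rewrite size_take ss m_n => i_m <-.
  rewrite nth_take // -leqNgt.
  by apply: leq_trans (sort_le (Ordinal (ltn_trans i_m m_n))) _.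
by apply: leq_trans (count_size _ _) _; rewrite size_drop ss.
Qed.

(** If the sorted entry at 0-based position [i] exceeded [i.+1], so would the [n - i] entries from
    there on, one more than the bound at [m = i.+1] permits. *)
Lemma parking_of_counts (t : n.-tuple nat) :
  (forall i, 0 < tnth t i <= n)%N ->
  (forall m, m < n -> count (fun x => m < x) t <= n - m)%N ->
  parking_function t.
Proof.
move=> t_n cnt; split=> // i; rewrite leqNgt; apply/negP => lt_i.
have i_n := ltn_ord i.
have [iS|iS] := ltnP i.+1 n; last first.
  have : nth 0%N (sort leq t) i \in t.
    by rewrite -(mem_sort leq) mem_nth // size_sort size_tuple.
  by case/tnthP => j ej; have := t_n j; rewrite -ej; lia.
have := cnt _ iS; have /permP <- : perm_eq (sort leq t) t by rewrite perm_sort.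
set s := sort leq t in lt_i *;
  have ss : size s = n by rewrite size_sort size_tuple.
rewrite -(cat_take_drop i s) count_cat.
have -> : count (fun x => i.+1 < x)%N (drop i s) = size (drop i s).
  apply/eqP; rewrite -all_count; apply/allP => x /(nthP 0%N)[j].
  rewrite size_drop ss nth_drop => j_n <-; apply: leq_trans lt_i _.
  apply: (sorted_leq_nth leq_trans leqnn _ (sort_sorted leq_total t)).
  - by rewrite inE ss.
  - by rewrite inE ss -ltn_subRL.
  - by rewrite leq_addr.
by rewrite size_drop ss; lia.
Qed.

(** The inequalities of the parking polytope, for vectors of natural numbers. *)
Definition dominated a :=
  (forall i, 0 < a i)%N /\
  forall A, (\sum_(i in A) a i <= tail_sum n (n - #|A|))%N.

Lemma dominated_le a i : dominated a -> (a i <= n)%N.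
Proof.
case=> _ /(_ [set i]); rewrite big_set1 cards1 => /leq_trans; apply.
have i_n := ltn_ord i; rewrite (tail_sumS (_ : n - 1 < n)%N); last by lia.
by rewrite (_ : (n - 1).+1 = n) ?tail_sumn ?addn0 //; lia.
Qed.

(** Each entry is the number of levels [m] below it; after exchanging the sums, level [m]
    contributes at most [minn #|A| (n - m)]. *)
Lemma parking_dominated (t : n.-tuple nat) :
  parking_function t -> dominated (tnth t).
Proof.
move=> park; have [t_n _] := park; split=> [i|A]; first by case/andP: (t_n i).
have c_n : (#|A| <= n)%N by rewrite -[leqRHS]card_ord max_card.
rewrite -sum_minn // (eq_bigr (fun i => \sum_(m < n) (m < tnth t i))%N);
  last first.
  by move=> i _; rewrite sum_ltn; apply/esym/minn_idPl; case/andP: (t_n i).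
rewrite exchange_big /=; apply: leq_sum => m _; rewrite leq_min; apply/andP;
  split.
  rewrite -sum1_card; elim/big_ind2: _ => // [? ? ? ?|i _];
    first exact: leq_add.
  by case: (_ < _)%N.
apply: leq_trans (count_gt_parking park (ltn_ord m)).
rewrite -sum1_count big_tuple big_mkcond [leqRHS]big_mkcond /=.
by apply: leq_sum => i _; case: (i \in A); case: (_ < _)%N.
Qed.

(** For distinct [p] and [q] with [a p = a q > 0], the vector [a] is the midpoint of [spread a p q]
    and [spread a q p]. *)
Definition spread a p q : 'I_n -> nat :=
  fun i => if i == p then (a p).+1 else if i == q then (a q).-1 else a i.

Lemma sum_eq_mem A (q : 'I_n) : (\sum_(i in A) (i == q) = (q \in A))%N.
Proof.
case: (boolP (q \in A)) => qA.
  by rewrite (bigD1 q) //= eqxx big1 // => i /andP[_ /negPf ->].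
by rewrite big1 // => i iA; case: eqP iA qA => // -> ->.
Qed.

Lemma spread_sum a p q A : p != q -> (0 < a q)%N ->
  (\sum_(i in A) spread a p q i + (q \in A) = \sum_(i in A) a i + (p \in A))%N.
Proof.
move=> pq aq; rewrite -!sum_eq_mem -!big_split; apply: eq_bigr => i _ /=.
rewrite /spread; case: (eqVneq i p) => [->|_]; first by rewrite (negPf pq); lia.
by case: (eqVneq i q) => [->|_]; lia.
Qed.

Lemma spread_sqr a p q : p != q -> (0 < a q)%N -> a p = a q ->
  (\sum_i spread a p q i ^ 2 = (\sum_i a i ^ 2).+2)%N.
Proof.
move=> pq aq apq.
have : (\sum_i (spread a p q i ^ 2 + (i == q) * (2 * a q))
  = \sum_i (a i ^ 2 + ((i == p) * (2 * a q).+1 + (i == q))))%N.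
  apply: eq_bigr => i _; rewrite /spread.
  case: (eqVneq i p) => [->|_]; first by rewrite (negPf pq) apq; lia.
  case: (eqVneq i q) => [->|_]; last by lia.
  by case: (a q) aq => // c _; rewrite /=; lia.
have sum1 (r : 'I_n) c : (\sum_i (i == r) * c = c)%N.
  by rewrite (bigD1 r) //= eqxx mul1n big1 ?addn0 // => i /negPf ->.
have sum1' (r : 'I_n) : (\sum_i (i == r) = 1)%N.
  by rewrite (bigD1 r) //= eqxx big1 ?addn0 // => i /negPf ->.
by rewrite !big_split /= !sum1 sum1'; lia.
Qed.

(** Only a tight set containing [p] but not [q] could violate its bound after spreading. *)
Lemma spread_dominated a p q : dominated a -> p != q -> a p = a q ->
  (1 < a q)%N -> dominated (spread a p q).
Proof.
move=> [a_gt0 a_le] pq apq aq; split=> [i|A].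
  by rewrite /spread; case: ifP => // _; case: ifP => // _; lia.
rewrite -(leq_add2r (q \in A)) (spread_sum A pq (ltnW aq)).
case: (boolP (q \in A)) => qA; first by rewrite leq_add ?leq_b1.
case: (boolP (p \in A)) => pA; last by rewrite leq_add.
rewrite addn0 addn1 ltnNge; apply/negP => tight.
(* The tight set [A] compared with [q |: A] and [A :\ p] bounds the common
   value [a p = a q] above by [n - #|A|] and below by [n - #|A| + 1]. *)
have A_lt : (#|A| < n)%N.
  rewrite -[ltnRHS](card_ord n) -cardsT; apply: proper_card.
  by apply/properP; split; [exact: subsetT | exists q].
have := a_le (q |: A); have := a_le (A :\ p); move: A_lt tight.
rewrite big_setU1 // cardsU1 qA (big_setD1 p) //= add1n.
have -> : #|A| = #|A :\ p|.+1 by rewrite (cardsD1 p) pA.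
move: #|A :\ p| (\sum_(i in A :\ p) a i)%N => c r c_lt.
by rewrite apq (tail_sum_sub c_lt) (tail_sum_sub (ltnW c_lt)); lia.
Qed.

(** For [m > 0] the entries above [m] are pairwise distinct numbers among [m.+1, ..., n], so there
    are at most [n - m] of them. *)
Lemma distinct_parking a : dominated a ->
  (forall p q, p != q -> a p = a q -> (a q <= 1)%N) ->
  parking_function [tuple a i | i < n].
Proof.
move=> dom inj; have a_n i := dominated_le i dom.
apply: parking_of_counts => [i|m m_n].
  by rewrite tnth_mktuple a_n andbT; case: dom.
have [->|m_gt0] := posnP m.
  by rewrite subn0; apply: leq_trans (count_size _ _) _; rewrite size_tuple.
rewrite -size_filter /= filter_map size_map.
set s := [seq i <- _ | _]; rewrite -(size_map a) -[leqRHS](size_iota m.+1).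
apply: uniq_leq_size.
  rewrite map_inj_in_uniq; first by rewrite filter_uniq ?enum_uniq.
  move=> p q; rewrite !mem_filter /= => /andP[mp _] /andP[mq _] apq.
  by apply/eqP/negPn/negP => /inj /(_ apq); lia.
move=> x /mapP[i]; rewrite mem_filter /= => /andP[mi _] ->.
by rewrite mem_iota mi /= addSn subnKC ?ltnS ?a_n // ltnW.
Qed.

End ParkingInequalities.

(** * Integer points of generalized permutohedra *)

From mathcomp Require Import boolp classical_sets cardinality.
From mathcomp Require Import interval_inference reals convex.
Local Open Scope classical_set_scope.

Section BasePoints.
Variable n : nat.
Notation X := {set 'I_n}.
Notation vec := {ffun X -> int}.
Implicit Types (A B I J U : X) (y : vec) (z w : 'rV[int]_n).

Definition coord_sum z A : int := \sum_(i in A) z 0 i.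

Definition base_points y : set 'rV[int]_n :=
  [set z | (forall A, lower y A <= coord_sum z A) /\
           coord_sum z [set: 'I_n]%SET = lower y [set: 'I_n]%SET].

Lemma coord_sumUI z A B :
  coord_sum z A + coord_sum z B
  = coord_sum z (A :|: B)%SET + coord_sum z (A :&: B)%SET.
Proof.
have csE C : coord_sum z C = \sum_i (if i \in C then z 0 i else 0).
  by rewrite -big_mkcond.
rewrite !csE -!big_split; apply: eq_bigr => i _ /=; rewrite !inE.
by case: (i \in A); case: (i \in B); rewrite /= ?addr0 ?add0r.
Qed.

Lemma coord_sum1 z i : coord_sum z [set i]%SET = z 0 i.
Proof. by rewrite /coord_sum big_set1. Qed.

Lemma coord_sumD1 z A i : i \in A ->
  coord_sum z A = z 0 i + coord_sum z (A :\ i)%SET.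
Proof. by move=> Ai; rewrite /coord_sum (big_setD1 i). Qed.

Lemma coord_sum_notin z A i : i \notin A ->
  coord_sum z (A :\ i)%SET = coord_sum z A.
Proof.
move=> iA; congr coord_sum; apply/setP => j; rewrite !finset.inE.
by case: eqP => //= ->; rewrite (negPf iA).
Qed.

Lemma coord_sum_delta z i A :
  coord_sum (z + delta_mx 0 i) A = coord_sum z A + (i \in A)%:R.
Proof.
rewrite /coord_sum (eq_bigr (fun j => z 0 j + (j == i)%:R)); last first.
  by move=> j _; rewrite !mxE eqxx.
rewrite big_split /=; congr (_ + _); case: (boolP (i \in A)) => iA.
  by rewrite (bigD1 i) //= eqxx big1 // => j /andP[_ /negPf ->].
by rewrite big1 // => j jA; case: eqP jA iA => // -> ->.
Qed.

Lemma finite_base_points y : finite_set (base_points y).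
Proof.
pose a i := lower y [set i]%SET.
(* The total excess over the coordinatewise lower bounds [a i], which bounds the excess of each
   coordinate. *)
pose M := `|(lower y [set: 'I_n]%SET - \sum_i a i)%R|%N.
pose g (f : {ffun 'I_n -> 'I_M.+1}) : 'rV[int]_n := \row_i (a i + (f i :
  nat)%:Z).
apply: (@sub_finite_set _ _ (range g)); last first.
  by apply: finite_image; apply: finite_finset.
move=> z [z_ge z_tot].
have ge_a i : a i <= z 0 i by rewrite -coord_sum1; apply: z_ge.
have le_M i : z 0 i - a i <= M%:Z.
  rewrite /M gez0_abs; last first.
    rewrite -z_tot /coord_sum subr_ge0 [leRHS](eq_bigl xpredT) => [|j];
      last by rewrite inE.
    exact: ler_sum.
  rewrite -z_tot /coord_sum [X in _ <= X - _](eq_bigl xpredT) => [|j];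
    last by rewrite inE.
  rewrite -sumrB (bigD1 i) //= lerDl; apply: sumr_ge0 => j _.
  by rewrite subr_ge0.
exists [ffun i => inord `|(z 0 i - a i)%R|%N] => //.
apply/rowP => i; rewrite !mxE ffunE inordK.
  by rewrite gez0_abs ?subr_ge0 // addrC subrK.
rewrite ltnS -lez_nat gez0_abs ?subr_ge0 //.
Qed.

Definition nb_base y : nat := #|` fset_set (base_points y)|.

Arguments nb_base y%_R.

Definition base_count y : rat := (nb_base y)%:R.

Lemma shift_image_count y i :
  #|` fset_set [set z + delta_mx 0 i | z in base_points y]| = nb_base y.
Proof.
rewrite fset_set_image; last exact: finite_base_points.
by rewrite /nb_base card_imfset //= => z w /addIr.
Qed.

(** The point sets for [I, J] and for [U, U] are the intersection and the union of those for [I, U]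
    and [J, U], so the relation is inclusion-exclusion. *)
Lemma base_count_modular : modular_rel base_count.
Proof.
move=> y I J U sy.
suff : (nb_base (y + unit_vec I + unit_vec J)
    + nb_base (y + unit_vec U + unit_vec U)
    = nb_base (y + unit_vec I + unit_vec U)
    + nb_base (y + unit_vec J + unit_vec U))%N.
  have natr_sum (a b c d : nat) :
      (a + b = c + d)%N -> a%:R + b%:R = c%:R + d%:R :> rat.
    by move=> abcd; rewrite -!natrD abcd.
  exact: natr_sum.
rewrite /nb_base.
set BI := base_points (y + unit_vec I + unit_vec U).
set BJ := base_points (y + unit_vec J + unit_vec U).
have lowerE K L A : lower (y + unit_vec K + unit_vec L) A
    = lower y A + (K \subset A)%:R + (L \subset A)%:R by rewrite !lower_shift.
have tot K L : lower (y + unit_vec K + unit_vec L) [set: 'I_n]%SET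
    = lower y [set: 'I_n]%SET + 1 + 1 by rewrite lowerE !finset.subsetT.
have UP A : (U \subset A) = (I \subset A) && (J \subset A) by rewrite /U
  finset.subUset.
have -> : base_points (y + unit_vec I + unit_vec J) = BI `&` BJ.
  apply/seteqP; split=> [z [zge ztot]|z [[zI ztot] [zJ _]]].
    rewrite tot in ztot; split; split; rewrite ?tot // => A;
    have := zge A; rewrite !lowerE UP;
    by case: (I \subset A); case: (J \subset A) => /=; lia.
  rewrite tot in ztot; split; rewrite ?tot // => A.
  have := zI A; have := zJ A; rewrite !lowerE UP.
  by case: (I \subset A); case: (J \subset A) => /=; lia.
have -> : base_points (y + unit_vec U + unit_vec U) = BI `|` BJ.
  apply/seteqP; split=> z; last first.
    case=> -[zge ztot]; rewrite tot in ztot; split; rewrite ?tot // => A;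
    have := zge A; rewrite !lowerE UP;
    by case: (I \subset A); case: (J \subset A) => /=; lia.
  (* If [z] failed the bounds for [I] at [A] and those for [J] at [B], it would be tight for [y] at
     both sets; [A :|: B] contains [U], whose two copies then contradict supermodularity. *)
  move=> [zge ztot]; rewrite tot in ztot.
  have [zI|/existsNP[A nA]] := pselect (forall A,
      lower (y + unit_vec I + unit_vec U) A <= coord_sum z A).
    by left; split; rewrite ?tot.
  right; split; rewrite ?tot // => B; rewrite leNgt; apply/negP => nB.
  have tight (K A' : X) :
      ~ (lower (y + unit_vec K + unit_vec U) A' <= coord_sum z A') ->
      K \subset A' /\ coord_sum z A' <= lower y A'.
    have := zge A'; rewrite !lowerE; case: (U \subset A') => /=;
    by case: (K \subset A') => /=; lia.
  have [IA cA] := tight I A nA.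
  have [JB cB] : J \subset B /\ coord_sum z B <= lower y B.
    by apply: tight; rewrite leNgt nB.
  have := sy A B; have := zge (A :|: B)%SET; have := zge (A :&: B)%SET.
  rewrite !lowerE (finset.setUSS IA JB).
  have := coord_sumUI z A B.
  by case: (U \subset A :&: B)%SET => /=; lia.
have finI : finite_set BI := finite_base_points _.
have finJ : finite_set BJ := finite_base_points _.
rewrite (fset_setU finI finJ) (fset_setI finI finJ) addnC.
exact: cardfsUI.
Qed.

Lemma base_points_loop y i : base_points (y + unit_vec [set i]%SET)
  = [set z + delta_mx 0 i | z in base_points y].
Proof.
apply/seteqP; split=> z /=.
  move=> [zge ztot]; exists (z - delta_mx 0 i); last by rewrite subrK.
  have cs A : coord_sum (z - delta_mx 0 i) A = coord_sum z A - (i \in A)%:R.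
    by rewrite -[in RHS](subrK (delta_mx 0 i) z) coord_sum_delta addrK.
  split=> [A|]; rewrite cs; last first.
    by rewrite ztot lower_shift !inE finset.subsetT addrK.
  by have := zge A; rewrite lower_shift finset.sub1set lerBrDr.
move=> [w [wge wtot] <-]; split=> [A|]; rewrite coord_sum_delta lower_shift.
  by rewrite finset.sub1set lerD2r.
by rewrite wtot inE finset.subsetT.
Qed.

Lemma base_count_loop : loop_rel base_count.
Proof.
move=> y i _; rewrite /base_count -(shift_image_count y i) -base_points_loop.
by [].
Qed.

(** A point for [y + unit_vec U] has [i]-th coordinate 0 or 1. Those with 0 are the points for
    [y + unit_vec (U :\ i)], and those with 1 are the points for [y] translated by
    [delta_mx 0 i]. *)
Lemma base_count_avoid : avoid_rel base_count.
Proof.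
move=> y U i _ y0 yi Ui _.
have lowerD1 A : lower y (A :\ i)%SET = lower y A.
  rewrite /lower [RHS](bigID (fun I : X => i \in I)) /= [X in _ = X + _]big1 =>
    [|I /andP[_]].
    by rewrite add0r; apply: eq_bigl => I; rewrite subsetD1.
  exact: yi.
have lower1 : lower y [set i]%SET = 0.
  rewrite -lowerD1 finset.setDv /lower (big_pred1 finset.set0) ?y0 // => I.
  by rewrite finset.subset0.
have totD1 z : coord_sum z [set: 'I_n]%SET
    = z 0 i + coord_sum z ([set: 'I_n] :\ i)%SET.
  by rewrite -coord_sumD1 ?finset.inE.
suff : nb_base (y + unit_vec U)
    = (nb_base (y + unit_vec (U :\ i)%SET) + nb_base y)%N.
  by move=> eqN; rewrite /base_count eqN natrD.
rewrite -(shift_image_count y i) /nb_base.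
set B' := base_points (y + unit_vec (U :\ i)%SET); set S := [set _ | _ in _].
have sub1 : (U :\ i \subset [set: 'I_n] :\ i)%SET.
  by apply: finset.setSD; apply: finset.subsetT.
have sub2 : (U \subset [set: 'I_n] :\ i)%SET = false.
  by apply/negP => /fintype.subsetP /(_ i Ui); rewrite !finset.inE eqxx.
have B'i z : B' z -> z 0 i <= 0.
  move=> [zge ztot]; have := zge ([set: 'I_n] :\ i)%SET.
  rewrite totD1 lower_shift finset.subsetT in ztot.
  by rewrite lower_shift lowerD1 sub1; lia.
have -> : base_points (y + unit_vec U) = B' `|` S.
  apply/seteqP; split=> z /=.
    move=> [zge ztot]; have := zge ([set: 'I_n] :\ i)%SET.
    have := zge [set i]%SET;
      rewrite coord_sum1 !lower_shift lower1 lowerD1 sub2.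
    rewrite lower_shift finset.subsetT in ztot;
      rewrite totD1 in ztot * => z1 z2.
    (* The bound at [[set i]] gives nonnegativity; the bound at its complement, compared with the
       total, gives at most 1. *)
    have [zi|zi] : z 0 i = 0 \/ z 0 i = 1.
      by move: ztot z1 z2; case: (U \subset _) => /=; lia.
      left; split=> [A|]; last by rewrite totD1 ztot lower_shift finset.subsetT.
      have := zge (i |: A)%SET; rewrite !lower_shift -finset.subDset.
      have iAD : ((i |: A) :\ i = A :\ i)%SET.
        by apply/setP => j; rewrite !finset.inE; case: eqP.
      rewrite -(lowerD1 (i |: A)%SET) iAD lowerD1.
      rewrite (@coord_sumD1 z (i |: A)%SET i) ?finset.setU11 // iAD zi add0r.
      case: (boolP (i \in A)) => iA; last by rewrite coord_sum_notin.
      by rewrite (coord_sumD1 z iA) zi add0r.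
    right; exists (z - delta_mx 0 i); last by rewrite subrK.
    have cs A : coord_sum (z - delta_mx 0 i) A = coord_sum z A - (i \in A)%:R.
      by rewrite -[in RHS](subrK (delta_mx 0 i) z) coord_sum_delta addrK.
    split=> [A|]; rewrite cs ?totD1 ?ztot ?finset.inE ?addrK //.
    case: (boolP (i \in A)) => iA.
      rewrite (coord_sumD1 _ iA) zi /= mulr1n [1 + _]addrC addrK -lowerD1.
      by apply: le_trans (zge _); rewrite lower_shift lerDl.
    by rewrite subr0; apply: le_trans (zge _); rewrite lower_shift lerDl.
  case=> [zB'|[w [wge wtot] <-]]; last first.
    split=> [A|]; rewrite coord_sum_delta lower_shift; last first.
      by rewrite wtot finset.subsetT finset.inE.
    apply: lerD => //; case: (boolP (U \subset A)) => // /fintype.subsetP /(_ i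
      Ui).
    by move=> ->.
  case: (zB') => [zge ztot]; split=> [A|]; last first.
    by rewrite ztot !lower_shift !finset.subsetT.
  apply: le_trans (zge A); rewrite !lower_shift lerD2l.
  case: (boolP (U \subset A)) => // /(fintype.subset_trans (subD1set U i)) ->
    //.
have finS : finite_set S by apply: finite_image; apply: finite_base_points.
rewrite fset_setU //; last exact: finite_base_points.
rewrite -cardfsUI -fset_setI //; last exact: finite_base_points.
suff -> : B' `&` S = set0 by rewrite fset_set0 cardfs0 addn0.
apply/seteqP; split=> // z [/B'i z_le0 [w [wge _] wz]].
have := wge [set i]%SET; rewrite coord_sum1 lower1.
by move: z_le0; rewrite -wz !mxE !eqxx /=; lia.
Qed.

Lemma base_count0 : base_count 0 = 1.
Proof.
have low0 A : lower 0 A = 0 by rewrite /lower big1 // => I _; rewrite ffunE.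
rewrite /base_count /nb_base (_ : base_points 0 = [set 0]) ?fset_set1 ?cardfs1
  //.
apply/seteqP; split=> z /=; last first.
  by move=> ->; split=> *; rewrite low0 /coord_sum big1 // => ? _; rewrite mxE.
move=> [zge ztot]; apply/rowP => i; rewrite mxE; apply/eqP.
rewrite eq_le -{2}coord_sum1 -{2}(low0 [set i]%SET) zge andbT.
rewrite -(low0 [set: 'I_n]%SET) -ztot (@coord_sumD1 _ _ i) ?inE // lerDl.
by rewrite -(low0 ([set: 'I_n] :\ i)%SET) zge.
Qed.

End BasePoints.

(** * Integer points of the parking polytope *)

Lemma base_count_drac_poly n (y : {ffun {set 'I_n} -> int}) : (0 < n)%N ->
  supermodular y -> y finset.set0 = 0 -> base_count y = drac_poly y.
Proof.
move=> n_gt0 sy y0; apply/eqP; rewrite -subr_eq0; apply/eqP.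
have dmod : modular_rel (@drac_poly n).
  by move=> z I J U _; apply: drac_poly_modular.
have dloop : loop_rel (@drac_poly n) by move=> z i _; apply: drac_poly_set1.
have davoid : avoid_rel (@drac_poly n).
  by move=> z U i _ _ zi Ui U1; apply: drac_poly_avoids.
apply: (supermodular_vanish (modular_relB (@base_count_modular n) dmod)
  (loop_relB (@base_count_loop n) dloop)
  (avoid_relB (@base_count_avoid n) davoid) _ sy y0).
by rewrite base_count0 drac_poly0 ?subrr.
Qed.

Section Polytope.
Variables (R : realType) (n : nat).
Implicit Types (A : {set 'I_n}) (a : 'I_n -> nat) (z : 'rV[int]_n).

(** Induction on the gap between [n * n ^ 2] and the sum of squares. If two coordinates share a
    value above 1, [a] is the midpoint of two spreads, whose sums of squares are larger by 2;
    otherwise [a] is a parking function. *)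
Lemma convex_dominated (B : set 'rV[R]_n) a :
  convex_set (B : set (convex_lmodType 'rV[R]_n)) ->
  parking_points R n `<=` B -> dominated a -> B (\row_i (a i)%:R).
Proof.
move=> cvxB parkB; have [m] := ubnP (n * n ^ 2 - \sum_i a i ^ 2)%N.
elim: m a => // m IH a lt_m dom.
have sqr_le (b : 'I_n -> nat) : dominated b -> (\sum_i b i ^ 2 <= n * n ^ 2)%N.
  move=> domb; apply: (@leq_trans (\sum_(i < n) n ^ 2)%N); last first.
    by rewrite sum_nat_const card_ord.
  by apply: leq_sum => i _; rewrite leq_exp2r // dominated_le.
have [/existsP[p /existsP[q /and3P[pq /eqP apq aq]]]|no_pq] := boolP
    [exists p, exists q, [&& p != q, a p == a q & (1 < a q)%N]]; last first.
  apply: parkB; exists [tuple a i | i < n]; last first.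
    by apply/rowP => i; rewrite !mxE tnth_mktuple.
  apply: distinct_parking => // p q pq apq; rewrite leqNgt;
    apply: contra no_pq => aq.
  by apply/existsP; exists p; apply/existsP; exists q; rewrite pq apq eqxx.
have spreadB r s : r != s -> a r = a s -> (1 < a s)%N ->
    B (\row_i (spread a r s i)%:R).
  move=> rs ars as1; have domS := spread_dominated dom rs ars as1.
  apply: IH => //; have := sqr_le _ domS.
  by rewrite spread_sqr ?(ltnW as1) //; lia.
have half_ge0 : 0 <= 1 / 2 :> R by [].
have half_le1 : 1 / 2 <= 1 :> R by rewrite ler_pdivrMr // mul1r ler1n.
have := cvxB (\row_i (spread a p q i)%:R) (\row_i (spread a q p i)%:R)
  (Itv01 half_ge0 half_le1).
rewrite !in_setE => /(_ (spreadB p q pq apq aq)).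
rewrite eq_sym in pq; rewrite -apq in aq.
move=> /(_ (spreadB q p pq (esym apq) aq)); congr (B _).
apply/rowP => i; rewrite !mxE /= /spread /unstable.onem.
have [->|ip] := eqVneq i p; last first.
  have [->|iq] := eqVneq i q; last by rewrite -mulrDl subrKC mul1r.
  rewrite -apq; case: (a p) aq => // c _;
    rewrite /= -[c.+2%:R]natr1 -[c.+1%:R]natr1.
  by clear; lra.
rewrite eq_sym (negPf pq); case: (a p) aq => // c _;
  rewrite /= -[c.+2%:R]natr1 -[c.+1%:R]natr1.
by clear; lra.
Qed.

Definition parking_region z :=
  (forall i, 1 <= z 0 i) /\
  forall A, coord_sum z A <= (tail_sum n (n - #|A|))%:Z.

Lemma parking_polytope_int z :
  parking_polytope R n (map_mx intr z) <-> parking_region z.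
Proof.
split=> [poly_z|[z_ge1 z_le]]; last first.
  have -> : map_mx intr z = \row_i (`|(z 0 i)%R|%N)%:R :> 'rV[R]_n.
    apply/rowP => i; rewrite !mxE pmulrn gez0_abs //.
    exact: le_trans (z_ge1 i).
  move=> B [cvxB parkB]; apply: convex_dominated => //.
  have abs i : (`|(z 0 i)%R|%N : int) = z 0 i.
    by rewrite gez0_abs // (le_trans _ (z_ge1 i)).
  split=> [i|A]; first by rewrite -ltz_nat abs (lt_le_trans _ (z_ge1 i)).
  rewrite -lez_nat; apply: le_trans _ (z_le A).
  rewrite /coord_sum -natz natr_sum.
  by apply: ler_sum => i _; rewrite natz abs.
(* The real inequalities cut out a convex set containing the parking points, hence containing their
   hull. *)
pose B0 : set 'rV[R]_n := [set x | (forall i, 1 <= x 0 i) /\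
  forall A, \sum_(i in A) x 0 i <= (tail_sum n (n - #|A|))%:R].
have : B0 (map_mx intr z).
  apply: poly_z; split=> [x y t|_ [t park <-]].
    have t_ge0 : 0 <= t%:num by [].
    have t_le1 : 0 <= 1 - t%:num by rewrite subr_ge0.
    have weight c : t%:num * c + (1 - t%:num) * c = c.
      by rewrite -mulrDl subrKC mul1r.
    have convE : conv t x y = t%:num *: x + (1 - t%:num) *: y :> 'rV[R]_n by [].
    rewrite !in_setE => -[x1 xA] [y1 yA]; rewrite convE; split=> [i|A].
      by rewrite !mxE -[X in X <= _]weight; apply: lerD; apply: ler_wpM2l.
    under eq_bigr do rewrite !mxE.
    rewrite big_split -!mulr_sumr -[X in _ <= X]weight.
    by apply: lerD; apply: ler_wpM2l.
  have [t1 tA] := parking_dominated park; split=> [i|A].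
    by rewrite mxE ler1n.
  under eq_bigr do rewrite mxE.
  by rewrite -natr_sum ler_nat.
case=> z1 zA; split=> [i|A].
  by have := z1 i; rewrite mxE -(ler_int R).
have := zA A; under eq_bigr do rewrite mxE.
by move=> zA_R; rewrite -(ler_int R) rmorph_sum; apply: zA_R.
Qed.

(** * Slices by coordinate sum *)

Lemma coord_sum_setT z : coord_sum z [set: 'I_n]%SET = \sum_i z 0 i.
Proof. by apply: eq_bigl => i; rewrite finset.inE. Qed.

Lemma coord_sumC z A :
  coord_sum z A + coord_sum z (~: A)%SET = coord_sum z [set: 'I_n]%SET.
Proof.
rewrite coord_sumUI finset.setUCr finset.setICr [X in _ + X](_ : _ = 0) ?addr0
  //.
by rewrite /coord_sum big_set0.
Qed.

(** With the total fixed at [S], the upper bound on the complement of [A] reads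
    [coord_sum z A >= S - tail_sum n #|A|]; together with [coord_sum z A >= #|A|] this is the bound
    by [xsum], as [xsum_cases] shows. *)
Lemma parking_slice_int S z : (n <= S <= (n * n.+1)./2)%N ->
  parking_slice R n S%:Z (map_mx intr z)
  <-> base_points [ffun I : {set 'I_n} => Ysub S I] z.
Proof.
move=> nS; have sum_z : \sum_i (map_mx intr z : 'rV[R]_n) 0 i = S%:Z%:~R <->
    coord_sum z [set: 'I_n]%SET = S.
  rewrite coord_sum_setT; under eq_bigr do rewrite mxE.
  by rewrite -rmorph_sum; split=> [/intr_inj|->].
have card_le A : (#|A| <= n)%N by rewrite -[leqRHS]card_ord max_card.
have cC A : #|(~: A)%SET| = (n - #|A|)%N by rewrite cardsCs finset.setCK
  card_ord.
rewrite /parking_slice /base_points /=; split.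
  move=> [/parking_polytope_int[z1 zA] /sum_z zS]; split=> [A|]; last first.
    by rewrite zS lower_Ysub cardsT card_ord (xsum_n nS).
  rewrite lower_Ysub; have [_ _ [->|xS]] := xsum_cases nS (card_le A).
    rewrite -sum1_card -natz natr_sum /coord_sum; apply: ler_sum => i _.
    exact: z1.
  rewrite -(lerD2r (coord_sum z (~: A)%SET)) coord_sumC zS.
  rewrite (_ : S%:Z = (xsum n S #|A|)%:Z + (tail_sum n #|A|)%:Z) ?lerD2l.
    by have := zA (~: A)%SET; rewrite cC subKn.
  by rewrite -PoszD xS.
move=> [zA zT]; have zS : coord_sum z [set: 'I_n]%SET = S.
  by rewrite zT lower_Ysub cardsT card_ord (xsum_n nS).
split; last exact/sum_z.
apply/parking_polytope_int; split=> [i|A].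
  rewrite -coord_sum1; apply: le_trans (zA _);
    rewrite lower_Ysub cards1 lez_nat.
  by have [] := xsum_cases nS (leq_ltn_trans (leq0n i) (ltn_ord i)).
rewrite -(lerD2r (coord_sum z (~: A)%SET)) coord_sumC zS.
have [_ S_le _] := xsum_cases nS (leq_subr #|A| n).
apply: le_trans (_ : (tail_sum n (n - #|A|))%:Z + (xsum n S (n - #|A|))%:Z <=
  _).
  by rewrite -PoszD lez_nat addnC.
by rewrite lerD2l -cC -lower_Ysub; apply: zA.
Qed.

Lemma finite_parking_region : finite_set [set z | parking_region z].
Proof.
pose g (f : {ffun 'I_n -> 'I_n.+1}) : 'rV[int]_n := \row_i (f i : nat)%:Z.
apply: (@sub_finite_set _ _ (range g)); last first.
  by apply: finite_image; apply: finite_finset.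
move=> z [z1 zA].
have z_le i : z 0 i <= n.
  rewrite -coord_sum1; apply: (le_trans (zA _)); rewrite cards1 lez_nat.
  have i_n := ltn_ord i; rewrite (tail_sumS (_ : n - 1 < n)%N); last by lia.
  by rewrite (_ : (n - 1).+1 = n) ?tail_sumn ?addn0 //; lia.
exists [ffun i => inord `|(z 0 i)%R|%N] => //.
by apply/rowP => i; rewrite mxE ffunE inordK; have := z1 i; have := z_le i; lia.
Qed.

Lemma nb_parking_slice S : (n <= S <= (n * n.+1)./2)%N ->
  nb_integer_points (parking_slice R n S%:Z)
  = nb_base [ffun I : {set 'I_n} => Ysub S I].
Proof.
move=> nS; rewrite /nb_integer_points /nb_base; congr (#|` fset_set _|).
by apply/seteqP; split=> z /=; apply parking_slice_int.
Qed.

Lemma nb_parking_polytope :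
  nb_integer_points (parking_polytope R n) =
    (\sum_(n <= S < (n * n.+1)./2.+1)
       nb_integer_points (parking_slice R n S%:Z))%N.
Proof.
set M := (n * n.+1)./2.
pose F (S : nat) := [set z : 'rV[int]_n | parking_slice R n S%:Z (map_mx intr
  z)].
have F_sum S z : F S z -> parking_region z /\ coord_sum z [set: 'I_n]%SET = S.
  case=> /parking_polytope_int ? e; split=> //; move: e.
  rewrite coord_sum_setT; under eq_bigr do rewrite mxE.
  by rewrite -rmorph_sum => /intr_inj.
have finF S : finite_set (F S).
  by apply: sub_finite_set finite_parking_region => z /F_sum[].
have n_le z : parking_region z -> (n%:Z <= coord_sum z [set: 'I_n]%SET <= M%:Z).
  move=> [z1 zA]; apply/andP; split; last first.
    by have := zA [set: 'I_n]%SET; rewrite cardsT card_ord subnn tail_sum0.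
  rewrite coord_sum_setT -[X in X%:Z](card_ord n) -sum1_card -natz natr_sum.
  by apply: ler_sum => i _; apply: z1.
have F0 S : (S < n)%N -> F S = set0.
  move=> Sn; apply/seteqP; split=> // z /F_sum[/n_le /andP[nz _] zS].
  by move: nz; rewrite zS lez_nat leqNgt Sn.
have trivF : trivIset setT F.
  by move=> S T _ _ [z [/F_sum[_ zS] /F_sum[_]]]; rewrite zS => -[].
(* The disjoint union is indexed from 0; the slices with [S < n] are empty and are discarded
   afterwards. *)
transitivity (\sum_(0 <= S < M.+1) nb_integer_points (parking_slice R n
  S%:Z))%N.
  rewrite big_mkord; apply: etrans (esym (trivIset_sum_card M.+1 finF trivF)).
  rewrite -bigcup_mkord /nb_integer_points; congr (#|` fset_set _|).
  apply/seteqP; split=> z /= => [poly_z|[S _ []]//].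
  have /parking_polytope_int reg_z := poly_z;
    have /andP[n_z z_M] := n_le z reg_z.
  exists `|(coord_sum z [set: 'I_n]%SET)%R|%N => /=; first by lia.
  split=> //; under eq_bigr do rewrite mxE.
  by rewrite -rmorph_sum -coord_sum_setT gez0_abs //; apply: le_trans n_z.
have n_M : (n <= M.+1)%N.
  apply: leqW; rewrite /M mulnC -[X in (_ * X)%N]/(n.+1.-1) -bin2.
  by case: (n) => // k; rewrite binS bin1 leq_addl.
rewrite (big_cat_nat (leq0n n) n_M) /= big_nat_cond big1 ?add0n // => S
  /andP[/andP[_ Sn] _].
by rewrite /nb_integer_points -/(F S) F0 // fset_set0 cardfs0.
Qed.

End Polytope.

Theorem theorem5p2 (R : realType) (n : nat) (hn : (1 <= n)%N) :
  nb_integer_points (parking_polytope R n) =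
    (\sum_(n <= S < (n * n.+1)./2.+1)
       nb_integer_points (parking_slice R n S%:Z))%N
  /\
  (forall S : nat, (n <= S <= (n * n.+1)./2)%N ->
    (nb_integer_points (parking_slice R n S%:Z))%:Q =
      1 / ((n.-1)`!)%:Q *
      \sum_(T : {ffun 'I_n.-1 -> {set 'I_n}} | dragon_marriage T)
         (bracket S (monomial_of T))%:Q).
Proof.
split=> [|S nS]; first exact: nb_parking_polytope.
rewrite bracket_sum // nb_parking_slice // -base_count_drac_poly //.
- exact: supermodular_Ysub.
- by rewrite ffunE /Ysub /ycoord cards0 big_geq.
Qed.
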